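(* (i) Let $(X_n)_{n \geq 1}$ and $(Y_n)_{n \geq 1}$ be non-degenerate random walks on $\mathbb{R}$ such that $\max(X_n, 0)$ and $\max(Y_n, 0)$ are equal in distribution for every $n = 1, 2, \ldots$. Then $X_n$ and $Y_n$ are equal in distribution for every $n = 1, 2, \ldots$. (ii) More generally, let $\mu$ and $\nu$ be non-degenerate finite signed Borel measures on $\mathbb{R}$ such that for every $n = 1, 2, \ldots$ the $n$-fold convolutions $\mu^{*n}$ and $\nu^{*n}$ agree on $(0, \infty)$ (that is, their restrictions to $(0,\infty)$ are equal). Then $\mu = \nu$.
   Context: A random walk on $\mathbb{R}$ is a sequence $X_n = \xi_1 + \cdots + \xi_n$, $n = 1, 2, \ldots$, where $\xi_1, \xi_2, \ldots$ are independent, identically distributed real random variables. A random walk $X_n$ is non-degenerate if $\mathbb{P}(X_n > 0) \neq 0$ (whether this holds does not depend on $n \geq 1$). A finite signed Borel measure $\mu$ on $\mathbb{R}$ is non-degenerate if the restriction of $\mu$ to $(0, \infty)$ is a non-zero measure. $\mu^{*n}$ denotes the $n$-fold convolution of $\mu$ with itself (so $\mu^{*1} = \mu$). *)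

(* Defs.v *)
From HB Require Import structures.
From mathcomp Require Import all_boot all_order all_algebra finmap.
From mathcomp Require Import all_classical all_reals all_analysis measurable_realfun.

Set Implicit Arguments.
Unset Strict Implicit.
Unset Printing Implicit Defensive.

Import Order.TTheory GRing.Theory Num.Theory.
Import numFieldNormedType.Exports.

Local Open Scope classical_set_scope.
Local Open Scope ring_scope.
Local Open Scope ereal_scope.

(* Set functions are compared on measurable sets only: measures and charges are
   total functions on [set T], with irrelevant values off the sigma-algebra. *)
Definition eq_on_measurable d (T : measurableType d) (R : realType)
    (mu nu : set T -> \bar R) : Prop :=
  forall A, measurable A -> mu A = nu A.

Definition eq_in_distribution (R : realType)
    d1 (T1 : measurableType d1) (P1 : probability T1 R)
    d2 (T2 : measurableType d2) (P2 : probability T2 R)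
    (X : {RV P1 >-> R}) (Y : {RV P2 >-> R}) : Prop :=
  eq_on_measurable (distribution P1 X) (distribution P2 Y).

Section random_walk.
Context d (T : measurableType d) (R : realType) (P : probability T R).

Definition mutually_independent (xi : nat -> {RV P >-> R}) : Prop :=
  forall (J : {fset nat}) (A : nat -> set R),
    (forall i, measurable (A i)) ->
    P (\bigcap_(i in [set` J]) (xi i @^-1` A i)) =
    \prod_(i <- J) P (xi i @^-1` A i).

Definition identically_distributed (xi : nat -> {RV P >-> R}) : Prop :=
  forall i j, eq_in_distribution (xi i) (xi j).

(* The walk consists of the [X n] with [0 < n]; [X 0] is unconstrained and the
   increments are numbered from 0. *)
Definition random_walk (X : nat -> {RV P >-> R}) : Prop :=
  exists xi : nat -> {RV P >-> R},
    [/\ mutually_independent xi, identically_distributed xi &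
      forall n, (0 < n)%N -> forall w, X n w = (\sum_(i < n) xi i w)%R].

(* For a random walk, whether [P (X n > 0) != 0] does not depend on [n > 0]. *)
Definition nondegenerate_walk (X : nat -> {RV P >-> R}) : Prop :=
  exists2 n, (0 < n)%N & P [set w | (0 < X n w)%R] != 0.

End random_walk.

Section finite_product.
Context d1 d2 (T1 : measurableType d1) (T2 : measurableType d2) (R : realType).
Variables (m1 : {finite_measure set T1 -> \bar R})
          (m2 : {finite_measure set T2 -> \bar R}).

Definition finite_product : set (T1 * T2) -> \bar R := m1 \x m2.

HB.instance Definition _ := Measure.on finite_product.

Let finite_product_fin : fin_num_fun finite_product.
Proof.
move=> A mA; rewrite ge0_fin_numE; last exact: measure_ge0.
apply: (@le_lt_trans _ _ (finite_product setT)).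
  by apply: le_measure => //; rewrite inE.
rewrite /finite_product -setXTT product_measure1E//.
by rewrite lte_mul_pinfty// ?fin_num_measure// -ge0_fin_numE// fin_num_measure.
Qed.

HB.instance Definition _ :=
  @Measure_isFinite.Build _ _ _ finite_product finite_product_fin.

End finite_product.

Section jordan_parts.
Context d (T : measurableType d) (R : realType).
Variable mu : {charge set T -> \bar R}.

(* The Jordan parts do not depend on the Hahn decomposition chosen here. *)
Let hahnP := svalP (cid (svalP (cid (Hahn_decomposition mu)))).

Definition charge_pos : {finite_measure set T -> \bar R} := jordan_pos hahnP.

Definition charge_neg : {finite_measure set T -> \bar R} := jordan_neg hahnP.

End jordan_parts.

Section charge_product.
Context d1 d2 (T1 : measurableType d1) (T2 : measurableType d2) (R : realType).
Variables (mu : {charge set T1 -> \bar R}) (nu : {charge set T2 -> \bar R}).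

(* (mu+ - mu-) x (nu+ - nu-), expanded. *)
Definition charge_product : {charge set (T1 * T2)%type -> \bar R} :=
  cadd (cadd (finite_product (charge_pos mu) (charge_pos nu))
             (finite_product (charge_neg mu) (charge_neg nu)))
       (copp (cadd (finite_product (charge_pos mu) (charge_neg nu))
                   (finite_product (charge_neg mu) (charge_pos nu)))).

End charge_product.

Section convolution.
Context (R : realType).
Variables mu nu : {charge set R -> \bar R}.

Let add (z : R * R) : R := (z.1 + z.2)%R.

Let measurable_add : measurable_fun setT add.
Proof. exact: measurable_funD. Qed.

Definition convolution : set R -> \bar R :=
  pushforward (charge_product mu nu) (fun z : R * R => (z.1 + z.2)%R).

HB.instance Definition _ := Charge.copy convolution
  (measure_function_pushforward__canonical__charge_Charge
    (charge_product mu nu) measurable_add).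

End convolution.

Section convolution_power.
Context (R : realType).

(* [mu] convolved with itself, [n] factors: the 1-fold one is [mu] on the nose,
   and the 0-fold one is the unit mass at the origin. *)
Definition convolution_pow (mu : {charge set R -> \bar R}) (n : nat) :
    {charge set R -> \bar R} :=
  iterop n (fun m1 m2 => convolution m1 m2) mu
    (charge_of_finite_measure (\d_(0%R : R))).

(* The restriction to (0, +oo). *)
Definition pos_restr (mu : {charge set R -> \bar R}) :
    {charge set R -> \bar R} :=
  crestr0 mu (measurable_itv `]0%R, +oo[).

Definition nondegenerate_charge (mu : {charge set R -> \bar R}) : Prop :=
  ~ eq_on_measurable (pos_restr mu) czero.

End convolution_power.

(* Main.v *)
Require Import Defs.
From HB Require Import structures.
From mathcomp Require Import all_boot all_order all_algebra finmap.
From mathcomp Require Import all_classical all_reals all_analysis measurable_realfun.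
From mathcomp Require Import ring lra.
Import Order.TTheory GRing.Theory Num.Theory.
Import numFieldNormedType.Exports.
Set Implicit Arguments.
Unset Strict Implicit.
Unset Printing Implicit Defensive.
Local Open Scope classical_set_scope.
Local Open Scope ring_scope.

(* Finite signed measures form a commutative ring under convolution. Put
   d = mu - nu and let K be the set of measures k such that nu^n * k is carried
   by (-oo, 0] for every n. Expanding mu^n = (nu + d)^n shows that d is in K, and
   K is stable under convolution by nu and under left translations.
   Suppose d <> 0. By uniqueness of the Laplace transform, the integral of
   exp(-s|x|) against d is nonzero for some s > 0. On the pre-Hilbert space of
   measures with <m, n> = int int exp(-s|x - y|) m(dx) n(dy), the measures carried
   by (-oo, 0] satisfy <k, delta_0> = int exp(-s|x|) k(dx), and translating k by
   -t multiplies this by exp(-st). Hence an approximate projection v of delta_0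
   onto K has autocorrelation <delta_x * v, v> close to a nonzero multiple of
   exp(-s|x|). Computing <delta_{-t} * nu * v, v>, first by linearity in nu and
   then by using that nu * v is in K, gives for all t >= 0
     int exp(-s|x - t|) nu(dx) = exp(-st) int exp(-s|x|) nu(dx).
   Thus int exp(st - s|x - t|) nu(dx) does not depend on t >= 0, and
   differentiating in t shows that nu vanishes on (0, +oo), a contradiction. *)

(** * Bounded measurable functions *)

Section bounded_measurable.
Context d (T : measurableType d) (R : realType).
Implicit Types (f g : T -> R) (A : set T).

Definition bmeas f := measurable_fun setT f /\ exists M, forall x, `|f x| <= M.

Lemma bmeas_cst (c : R) : bmeas (fun=> c).
Proof. by split; [exact: measurable_cst|exists `|c|]. Qed.

Lemma bmeasD f g : bmeas f -> bmeas g -> bmeas (fun x => f x + g x).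
Proof.
move=> [mf [M fM]] [mg [N gN]]; split; first exact: measurable_funD.
by exists (M + N) => x; rewrite (le_trans (ler_normD _ _))// lerD.
Qed.

Lemma bmeasM f g : bmeas f -> bmeas g -> bmeas (fun x => f x * g x).
Proof.
move=> [mf [M fM]] [mg [N gN]]; split; first exact: measurable_funM.
by exists (M * N) => x; rewrite normrM ler_pM.
Qed.

Lemma bmeasZ c f : bmeas f -> bmeas (fun x => c * f x).
Proof. exact: bmeasM (bmeas_cst c). Qed.

Lemma bmeasN f : bmeas f -> bmeas (fun x => - f x).
Proof.
by move=> /(bmeasZ (-1)); under [X in bmeas X]eq_fun do rewrite mulN1r.
Qed.

Lemma bmeasB f g : bmeas f -> bmeas g -> bmeas (fun x => f x - g x).
Proof. by move=> bf /bmeasN; exact: bmeasD. Qed.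

Lemma bmeas_indic A : measurable A -> bmeas (\1_A).
Proof.
move=> mA; split; first exact: measurable_indic.
by exists 1 => x; rewrite indicE; case: (_ \in _); rewrite ?normr0 ?normr1.
Qed.

Lemma bmeas_lim (f_ : nat -> T -> R) f (M : R) : (forall n, bmeas (f_ n)) ->
  (forall n x, `|f_ n x| <= M) -> (forall x, f_ ^~ x @ \oo --> f x) ->
  bmeas f.
Proof.
move=> bf_ fM f_f; split.
  by apply: (measurable_fun_cvg (h := f_)) => [n|x _]; [case: (bf_ n)|exact: f_f].
exists M => x; have := @cvg_norm _ _ _ _ _ _ _ (f_f x).
by move=> /(_ _)/cvgr_to_le; apply; apply: nearW => n.
Qed.

Lemma bmeas_sum (I : Type) (s : seq I) (F : I -> T -> R) :
  (forall i, bmeas (F i)) -> bmeas (fun x => \sum_(i <- s) F i x).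
Proof.
move=> bF; elim: s => [|i s IH].
  by under [X in bmeas X]eq_fun do rewrite big_nil; exact: bmeas_cst.
by under [X in bmeas X]eq_fun do rewrite big_cons; exact: bmeasD.
Qed.

Lemma bmeas_ge0_le f (M : R) : measurable_fun setT f ->
  (forall x, 0 <= f x <= M) -> bmeas f.
Proof.
move=> mf fM; split => //; exists M => x.
by have /andP[f0 ?] := fM x; rewrite ger0_norm.
Qed.

End bounded_measurable.

Lemma bmeas_comp d1 d2 (T1 : measurableType d1) (T2 : measurableType d2)
    (R : realType) (f : T2 -> R) (g : T1 -> T2) :
  bmeas f -> measurable_fun setT g -> bmeas (fun x => f (g x)).
Proof.
by move=> [mf [M fM]] mg; split; [exact: measurableT_comp|exists M => x].
Qed.

(** * Functional monotone class theorem *)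

Section monotone_class.
Context d (T : measurableType d) (R : realType).
Variables (G : set (set T)) (P : (T -> R) -> Prop).
Hypotheses (GE : @measurable _ T = <<s G >>) (GI : setI_closed G).
Hypothesis PG : forall A, G A -> P \1_A.
Hypothesis P1 : P (fun=> 1).
Hypothesis PL : forall a f g, bmeas f -> bmeas g -> P f -> P g ->
  P (fun x => a * f x + g x).
Hypothesis Plim : forall (f_ : nat -> T -> R) f (M : R), (forall n, bmeas (f_ n)) ->
  bmeas f -> (forall n x, `|f_ n x| <= M) -> (forall x, f_ ^~ x @ \oo --> f x) ->
  (forall n, P (f_ n)) -> P f.

Let P0 : P (fun=> 0).
Proof.
have := PL (-1) (bmeas_cst T 1) (bmeas_cst T 1) P1 P1.
by congr P; apply/funext => x; ring.
Qed.

Let Psum (I : Type) (s : seq I) (c : I -> R) (F : I -> T -> R) :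
  (forall i, bmeas (F i)) -> (forall i, P (F i)) ->
  P (fun x => \sum_(i <- s) c i * F i x).
Proof.
move=> bF PF; elim: s => [|i s IH].
  by under [X in P X]eq_fun do rewrite big_nil.
under [X in P X]eq_fun do rewrite big_cons.
by apply: PL => //; apply: bmeas_sum => j; exact: bmeasZ.
Qed.

Let P_indic A : measurable A -> P \1_A.
Proof.
rewrite GE; move: A.
apply: (dynkin_induction (P := fun A => P \1_A) GE GI) => //.
- by rewrite indicT.
- move=> A mA PA; have := PL (-1) (bmeas_indic R mA) (bmeas_cst T 1) PA P1.
  congr P; apply/funext => x; rewrite !indicE in_setC.
  by case: (x \in A) => /=; ring.
- move=> F mF tF PF.
  (* By disjointness at most one indicator is nonzero at [x], so the partial sums stay bounded by 1,
     as [Plim] requires. *)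
  have sumE n x : \sum_(i <- index_iota 0 n) 1 * \1_(F i) x =
      if has (fun i => x \in F i) (index_iota 0 n) then 1 else 0 :> R.
    elim: (index_iota 0 n) (iota_uniq _ _ : uniq (index_iota 0 n)) => [|i s IH] /=.
      by rewrite big_nil.
    rewrite big_cons => /andP[nis us]; rewrite IH// indicE.
    have [Fix|_] /= := boolP (x \in F i); last by rewrite mulr0 add0r.
    case: ifPn => [/hasP[j js Fjx]|_]; last by rewrite mulr1 addr0.
    have := tF i j I I (ex_intro _ x (conj (set_mem Fix) (set_mem Fjx))).
    by move=> ij; move: nis; rewrite ij js.
  apply: (@Plim (fun n x => \sum_(i <- index_iota 0 n) 1 * \1_(F i) x) _ 1).
  + by move=> n; apply: bmeas_sum => i; apply: bmeasZ; exact: bmeas_indic.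
  + by apply: bmeas_indic; exact: bigcup_measurable.
  + by move=> n x; rewrite sumE; case: ifP; rewrite ?normr0 ?normr1.
  + move=> x; under eq_fun do rewrite sumE.
    have [[k Fkx]|nF] := pselect (exists k, F k x); last first.
      rewrite indicE memNset; last by move=> [k _ Fkx]; apply: nF; exists k.
      apply: cvg_near_cst; apply: nearW => n; case: ifPn => //.
      by move=> /hasP[k _]; rewrite inE => Fkx; case: nF; exists k.
    rewrite indicE mem_set; last by exists k.
    apply: cvg_near_cst; exists k.+1 => // n /= kn.
    case: ifPn => // /hasPn/(_ k); rewrite mem_index_iota kn => /(_ isT)/negP.
    by rewrite inE.
  + by move=> n; apply: Psum => i //; exact: bmeas_indic.
Qed.

Import HBNNSimple.

Let P_nnsfun (f : {nnsfun T >-> R}) : P f.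
Proof.
have -> : (f : T -> R) = fun x =>
    \sum_(y <- fset_set (range f)) y * \1_(f @^-1` [set y]) x.
  by apply/funext => x; rewrite fimfunE fsbig_finite.
apply: Psum => y; first exact: bmeas_indic.
by apply: P_indic.
Qed.

(** Dynkin's lemma carries [P] from the pi-system to all measurable indicators, linearity to simple
    functions, and bounded limits to the rest. The approximation is by nonnegative simple functions,
    so [f] is first shifted by its bound. *)
Lemma monotone_class f : bmeas f -> P f.
Proof.
move=> bf; have [mf [M fM]] := bf.
pose g x := f x + M.
have bg : bmeas g by exact: bmeasD bf (bmeas_cst _ _).
have g0 x : 0 <= g x by have := fM x; rewrite ler_norml => /andP[]; rewrite /g; lra.
have Pg : P g.
  have mg : measurable_fun setT (EFin \o g) by apply/measurable_EFinP; case: bg.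
  pose h := nnsfun_approx measurableT mg.
  have eg0 x : setT x -> (0 <= (EFin \o g) x)%E by rewrite lee_fin.
  have hg n x : h n x <= g x.
    by rewrite -lee_fin nnsfun_approxE; exact: (le_approx _ eg0).
  have hM n x : `|h n x| <= M + M.
    by rewrite ger0_norm// (le_trans (hg n x))// lerD// (le_trans (ler_norm _)).
  apply: (@Plim (fun n => h n) _ (M + M)) => //.
  - by move=> n; split; [exact: measurable_funP|exists (M + M)].
  - move=> x; rewrite /h; under eq_fun do rewrite nnsfun_approxE.
    by apply: (cvg_approx eg0) => //=; rewrite ltry.
have := PL (- M) (bmeas_cst _ 1) bg P1 Pg.
by congr P; apply/funext => x; rewrite /g; ring.
Qed.
End monotone_class.

(** * Continuous functionals and signed measures *)

Lemma setI_closed_rectangles d1 d2 (T1 : measurableType d1)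
    (T2 : measurableType d2) :
  setI_closed [set A `*` B | A in @measurable _ T1 & B in @measurable _ T2].
Proof.
move=> _ _ [A1 mA1 [A2 mA2 <-]] [B1 mB1 [B2 mB2 <-]]; rewrite -setXI.
exists (A1 `&` B1); first exact: measurableI.
by exists (A2 `&` B2) => //; exact: measurableI.
Qed.

Section continuous_functional.
Context d (T : measurableType d) (R : realType).
Implicit Types (phi psi : (T -> R) -> R) (f g : T -> R).

(** Integration against a finite signed measure, axiomatically: linearity, boundedness in the sup
    norm, and continuity under bounded pointwise convergence, which stands for countable
    additivity. *)
Definition continuous_functional phi :=
  [/\ forall a f g, bmeas f -> bmeas g ->
        phi (fun x => a * f x + g x) = a * phi f + phi g,
      exists2 C : R, 0 <= C & forall f (M : R), bmeas f ->
        (forall x, `|f x| <= M) -> `|phi f| <= C * M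
    & forall (f_ : nat -> T -> R) f (M : R), (forall n, bmeas (f_ n)) ->
        (forall n x, `|f_ n x| <= M) -> (forall x, f_ ^~ x @ \oo --> f x) ->
        phi (f_ n) @[n --> \oo] --> phi f].

Lemma continuous_functional0 : continuous_functional (fun=> 0).
Proof.
split=> [*||*]; [by ring| |exact: cvg_cst].
by exists 0 => // f M _ _; rewrite mul0r normr0.
Qed.

Lemma continuous_functionalZ c phi : continuous_functional phi ->
  continuous_functional (fun f => c * phi f).
Proof.
move=> [phiL [C C0 phiC] phi_cvg]; split.
- by move=> a f g bf bg; rewrite phiL//; ring.
- exists (`|c| * C); first exact: mulr_ge0.
  by move=> f M bf fM; rewrite normrM -mulrA ler_wpM2l// phiC.
- by move=> f_ f M bf_ fM f_f; apply: cvgMr; exact: phi_cvg f_f.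
Qed.

Lemma continuous_functional_mul phi w : bmeas w -> continuous_functional phi ->
  continuous_functional (fun f => phi (fun x => f x * w x)).
Proof.
move=> bw [phiL [C C0 phiC] phi_cvg]; have [_ [W wW]] := bw; split.
- move=> a f g bf bg; rewrite -phiL; [|exact: bmeasM..].
  by congr (phi _); apply/funext => x; ring.
- exists (C * `|W|); first exact: mulr_ge0.
  move=> f M bf fM; rewrite -mulrA; apply: phiC => [|x]; first exact: bmeasM.
  by rewrite normrM mulrC ler_pM// (le_trans (wW x))// ler_norm.
- move=> f_ f M bf_ fM f_f; apply: (phi_cvg _ _ (M * W)) => [n|n x|x].
  + exact: bmeasM.
  + by rewrite normrM ler_pM.
  + by apply: cvgMl; exact: f_f.
Qed.

(** The functions on which both functionals agree form a monotone class. The constant 1 is treated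
    separately because [G] may fail to contain the whole space. *)
Lemma continuous_functional_eq (G : set (set T)) phi psi :
  @measurable _ T = <<s G >> -> setI_closed G ->
  continuous_functional phi -> continuous_functional psi ->
  (forall A, G A -> phi \1_A = psi \1_A) -> phi (fun=> 1) = psi (fun=> 1) ->
  forall f, bmeas f -> phi f = psi f.
Proof.
move=> GE GI [phiL _ phi_cvg] [psiL _ psi_cvg] phipsi phipsi1 f.
apply: (monotone_class (P := fun f => phi f = psi f) GE GI) => //.
- by move=> a g h bg bh Eg Eh; rewrite phiL// psiL// Eg Eh.
- move=> f_ g M bf_ bg fM f_g E.
  have := phi_cvg _ _ _ bf_ fM f_g; under eq_fun do rewrite E.
  by move=> l; exact: (cvg_unique _ l (psi_cvg _ _ _ bf_ fM f_g)).
Qed.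

End continuous_functional.

Lemma continuous_functional_comp d1 d2 (T1 : measurableType d1)
    (T2 : measurableType d2) (R : realType) (phi : (T1 -> R) -> R)
    (X : T1 -> T2) : measurable_fun setT X -> continuous_functional phi ->
  continuous_functional (fun f : T2 -> R => phi (fun t => f (X t))).
Proof.
move=> mX [phiL [C C0 phiC] phi_cvg].
have bX (f : T2 -> R) : bmeas f -> bmeas (fun t => f (X t)).
  by move=> bf; exact: bmeas_comp bf mX.
split.
- by move=> a f g bf bg; rewrite phiL//; exact: bX.
- by exists C => // f M bf fM; apply: phiC => //; exact: bX.
- move=> f_ f M bf_ fM f_f; apply: (phi_cvg _ _ M) => // n; exact: bX.
Qed.

(** * Finite signed measures and Fubini's theorem *)

Section signed_measure.
Context (R : realType).
Implicit Types (f g : R -> R).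

(* A finite signed measure is encoded by its integral, restricted to bounded
   measurable functions and extended by 0: equality is then Leibniz equality. *)
Record smeas := Smeas {
  ev :> (R -> R) -> R ;
  ev_continuous_functional : continuous_functional ev ;
  ev_junk : forall f, ~ bmeas f -> ev f = 0 }.

Lemma smeas_eq (m n : smeas) : (forall f, bmeas f -> m f = n f) -> m = n.
Proof.
case: m n => [m mc mj] [n nc nj] /= mn.
suff E : m = n by subst n; congr Smeas; exact: Prop_irrelevance.
apply/funext => f; have [/mn//|nf] := pselect (bmeas f).
by rewrite mj// nj.
Qed.

Lemma bmeas_pair1 (F : R * R -> R) x : bmeas F -> bmeas (fun y => F (x, y)).
Proof. by move=> bF; apply: bmeas_comp bF _; exact: measurable_pair1. Qed.

Lemma bmeas_pair2 (F : R * R -> R) y : bmeas F -> bmeas (fun x => F (x, y)).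
Proof. by move=> bF; apply: bmeas_comp bF _; exact: measurable_pair2. Qed.

Section ev_theory.
Variable m : smeas.

Lemma evL a f g : bmeas f -> bmeas g ->
  m (fun x => a * f x + g x) = a * m f + m g.
Proof. by case: (ev_continuous_functional m) => + _ _; exact. Qed.

Lemma evB f g : bmeas f -> bmeas g -> m (fun x => f x - g x) = m f - m g.
Proof.
move=> bf bg; rewrite addrC -mulN1r -evL//.
by congr (m _); apply/funext => x; rewrite mulN1r addrC.
Qed.

Lemma ev0 : m (fun=> 0) = 0.
Proof.
have b0 := @bmeas_cst _ R R 0; rewrite -[RHS](subrr (m (fun=> 0))) -evB//.
by congr (m _); apply/funext => x; rewrite subrr.
Qed.

Lemma evZ a f : bmeas f -> m (fun x => a * f x) = a * m f.
Proof.
move=> bf; have := evL a bf (bmeas_cst _ 0); rewrite ev0 addr0 => <-.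
by congr (m _); apply/funext => x; rewrite addr0.
Qed.

Lemma ev_bound : exists2 C : R, 0 <= C & forall f (M : R), bmeas f ->
  (forall x, `|f x| <= M) -> `|m f| <= C * M.
Proof. by case: (ev_continuous_functional m). Qed.

Lemma ev_cvg (f_ : nat -> R -> R) f (M : R) : (forall n, bmeas (f_ n)) ->
  (forall n x, `|f_ n x| <= M) -> (forall x, f_ ^~ x @ \oo --> f x) ->
  m (f_ n) @[n --> \oo] --> m f.
Proof. by case: (ev_continuous_functional m) => _ _; exact. Qed.

(** Measurability of a partial integral follows by monotone class from rectangles, for which the
    integral factors. *)
Lemma bmeas_ev (F : R * R -> R) : bmeas F ->
  bmeas (fun x => m (fun y => F (x, y))).
Proof.
apply: (monotone_class (P := fun F => bmeas (fun x => m (fun y => F (x, y))))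
  (measurable_prod_measurableType R R)).
- exact: setI_closed_rectangles.
- move=> _ [A mA [B mB <-]].
  have -> : (fun x => m (fun y => \1_(A `*` B) (x, y))) =
            (fun x => \1_A x * m \1_B).
    apply/funext => x; rewrite -evZ//; last exact: bmeas_indic.
    congr (m _); apply/funext => y; rewrite !indicE in_setX.
    by case: (_ \in A) => /=; rewrite ?mul0r ?mul1r.
  by apply: bmeasM; [exact: bmeas_indic|exact: bmeas_cst].
- exact: bmeas_cst.
- move=> a F1 F2 b1 b2 P1 P2.
  have -> : (fun x => m (fun y => a * F1 (x, y) + F2 (x, y))) =
      fun x => a * m (fun y => F1 (x, y)) + m (fun y => F2 (x, y)).
    by apply/funext => x; rewrite evL//; exact: bmeas_pair1.
  by apply: bmeasD => //; exact: bmeasZ.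
- move=> F_ G M bF_ bG F_M F_G PF.
  have [C C0 mC] := ev_bound.
  apply: (bmeas_lim (f_ := fun n x => m (fun y => F_ n (x, y))) (M := C * M)) => //.
    by move=> n x; apply: mC => //; exact: bmeas_pair1.
  by move=> x; apply: (ev_cvg (M := M)) => // n; exact: bmeas_pair1.
Qed.

End ev_theory.

Lemma bmeas_ev2 (m : smeas) (F : R * R -> R) : bmeas F ->
  bmeas (fun y => m (fun x => F (x, y))).
Proof.
move=> bF; apply: (bmeas_ev m (F := fun z => F (z.2, z.1))).
by apply: bmeas_comp bF _; exact: measurable_swap.
Qed.

(** This iterated integral plays the role of the product measure. *)
Lemma continuous_functional_iter (m n : smeas) :
  continuous_functional (fun F : R * R -> R => m (fun x => n (fun y => F (x, y)))).
Proof.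
have [C C0 mC] := ev_bound m; have [D D0 nD] := ev_bound n; split.
- move=> a F G bF bG; rewrite -evL; [|exact: bmeas_ev..].
  by congr (m _); apply/funext => x; rewrite evL//; exact: bmeas_pair1.
- exists (C * D); first exact: mulr_ge0.
  move=> F M bF FM; rewrite -mulrA; apply: mC; first exact: bmeas_ev.
  by move=> x; apply: nD => //; exact: bmeas_pair1.
- move=> F_ F M bF_ FM F_F; apply: (ev_cvg (M := D * M)) => [k|k x|x].
  + exact: bmeas_ev.
  + by apply: nD => //; exact: bmeas_pair1.
  + by apply: (ev_cvg (M := M)) => // k; exact: bmeas_pair1.
Qed.

Lemma ev_iter_rectangle (m n : smeas) (A B : set R) : measurable A ->
  measurable B ->
  m (fun x => n (fun y => \1_(A `*` B) (x, y))) = m \1_A * n \1_B.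
Proof.
move=> mA mB; have bA := bmeas_indic R mA; have bB := bmeas_indic R mB.
rewrite mulrC -evZ//; congr (m _); apply/funext => x.
rewrite mulrC -evZ//; congr (n _); apply/funext => y.
by rewrite !indicE in_setX; case: (_ \in A) => /=; rewrite ?mul0r ?mul1r.
Qed.

(** Both orders of integration are continuous functionals on the plane, and on a rectangle both give
    the product of the two masses. *)
Lemma ev_Fubini (m n : smeas) (F : R * R -> R) : bmeas F ->
  m (fun x => n (fun y => F (x, y))) = n (fun y => m (fun x => F (x, y))).
Proof.
have E A B : measurable A -> measurable B ->
    m (fun x => n (fun y => \1_(A `*` B) (x, y))) =
    n (fun y => m (fun x => \1_(A `*` B) (x, y))).
  move=> mA mB; rewrite ev_iter_rectangle// mulrC -(ev_iter_rectangle n m)//.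
  congr (n _); apply/funext => y; congr (m _); apply/funext => x.
  by rewrite !indicE !in_setX andbC.
apply: (continuous_functional_eq
  (phi := fun F => m (fun x => n (fun y => F (x, y))))
  (psi := fun F => n (fun y => m (fun x => F (x, y))))
  (measurable_prod_measurableType R R)).
- exact: setI_closed_rectangles.
- exact: continuous_functional_iter.
- exact: (continuous_functional_comp (@measurable_swap _ _ R R)
    (continuous_functional_iter n m)).
- by move=> _ [A mA [B mB <-]]; exact: E.
- have := E setT setT measurableT measurableT.
  by rewrite setXTT indicT.
Qed.

End signed_measure.

(** * The convolution ring *)

Section smeas_ring.
Context (R : realType).
Implicit Types (f g : R -> R) (m n p : smeas R).

(** Imposes the value 0 required by [ev_junk], so that a functional need only be specified on
    bounded measurable functions. *)
Definition restrict_bmeas (phi : (R -> R) -> R) f :=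
  if `[< bmeas f >] then phi f else 0.

Lemma restrict_bmeasE phi f : bmeas f -> restrict_bmeas phi f = phi f.
Proof. by move=> bf; rewrite /restrict_bmeas asboolT. Qed.

Lemma restrict_bmeas_junk phi f : ~ bmeas f -> restrict_bmeas phi f = 0.
Proof. by move=> bf; rewrite /restrict_bmeas asboolF. Qed.

Lemma restrict_bmeas_continuous phi : continuous_functional phi ->
  continuous_functional (restrict_bmeas phi).
Proof.
move=> [phiL [C C0 phiC] phi_cvg]; split.
- move=> a f g bf bg; rewrite !restrict_bmeasE ?phiL//.
  by apply: bmeasD => //; exact: bmeasZ.
- by exists C => // f M bf fM; rewrite restrict_bmeasE// phiC.
- move=> f_ f M bf_ fM f_f; have bf := bmeas_lim bf_ fM f_f.
  rewrite restrict_bmeasE//; under eq_fun do rewrite restrict_bmeasE//.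
  exact: phi_cvg f_f.
Qed.

Definition mk_smeas phi (c : continuous_functional phi) : smeas R :=
  Smeas (restrict_bmeas_continuous c) (@restrict_bmeas_junk phi).

Lemma mk_smeasE phi (c : continuous_functional phi) f :
  bmeas f -> mk_smeas c f = phi f.
Proof. exact: restrict_bmeasE. Qed.

Fact dirac_subproof (x : R) : continuous_functional (fun f => f x).
Proof.
split=> [//||f_ f M _ _]; last exact.
by exists 1 => // f M _ fM; rewrite mul1r.
Qed.

Definition smeas_dirac x := mk_smeas (dirac_subproof x).

Fact add_subproof m n : continuous_functional (fun f => m f + n f).
Proof.
have [C C0 mC] := ev_bound m; have [D D0 nD] := ev_bound n; split.
- by move=> a f g bf bg; rewrite !evL//; ring.
- exists (C + D); first exact: addr_ge0.
  by move=> f M bf fM; rewrite mulrDl (le_trans (ler_normD _ _))// lerD ?mC ?nD.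
- by move=> f_ f M bf_ fM f_f; apply: cvgD; exact: ev_cvg f_f.
Qed.

Definition smeas_add m n := mk_smeas (add_subproof m n).

Definition smeas_scale c m := mk_smeas
  (continuous_functionalZ c (ev_continuous_functional m)).

Lemma bmeas_shift f : bmeas f -> bmeas (fun z : R * R => f (z.1 + z.2)).
Proof.
by move=> bf; apply: bmeas_comp bf _; apply: measurable_funD;
  [exact: measurable_fst|exact: measurable_snd].
Qed.

Lemma bmeas_shiftl f (x : R) : bmeas f -> bmeas (fun y : R => f (x + y)).
Proof. by move=> /bmeas_shift/(bmeas_pair1 x). Qed.

Lemma bmeas_ev_shift m f : bmeas f -> bmeas (fun x : R => m (fun y => f (x + y))).
Proof. by move=> /bmeas_shift/(bmeas_ev m). Qed.

(** Convolution is the image of the product measure under addition. *)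
Fact mul_subproof m n :
  continuous_functional (fun f => m (fun x => n (fun y => f (x + y)))).
Proof.
have mD : measurable_fun setT (fun z : R * R => z.1 + z.2).
  by apply: measurable_funD; [exact: measurable_fst|exact: measurable_snd].
exact: (continuous_functional_comp mD (continuous_functional_iter m n)).
Qed.

Definition smeas_mul m n := mk_smeas (mul_subproof m n).

Definition smeas_zero := mk_smeas (@continuous_functional0 _ R R).

Let addA : associative smeas_add.
Proof. by move=> m n p; apply: smeas_eq => f bf; rewrite !mk_smeasE// addrA. Qed.

Let addC : commutative smeas_add.
Proof. by move=> m n; apply: smeas_eq => f bf; rewrite !mk_smeasE// addrC. Qed.

Let add0 : left_id smeas_zero smeas_add.
Proof. by move=> m; apply: smeas_eq => f bf; rewrite !mk_smeasE// add0r. Qed.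

Let addN : left_inverse smeas_zero (smeas_scale (-1)) smeas_add.
Proof.
by move=> m; apply: smeas_eq => f bf; rewrite !mk_smeasE// mulN1r addNr.
Qed.

HB.instance Definition _ := gen_eqMixin (smeas R).
HB.instance Definition _ := gen_choiceMixin (smeas R).
HB.instance Definition _ := GRing.isZmodule.Build (smeas R) addA addC add0 addN.

Let mulA : associative smeas_mul.
Proof.
move=> m n p; apply: smeas_eq => f bf;
rewrite !mk_smeasE; [|exact: bmeas_ev_shift|by[]|by[]].
congr (m _); apply/funext => x.
rewrite mk_smeasE; last exact: bmeas_shiftl.
congr (n _); apply/funext => y; congr (p _); apply/funext => z.
by rewrite addrA.
Qed.

Let mulC : commutative smeas_mul.
Proof.
move=> m n; apply: smeas_eq => f bf; rewrite !mk_smeasE//.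
rewrite (ev_Fubini m n (bmeas_shift bf)) /=; congr (n _); apply/funext => x.
by congr (m _); apply/funext => y; rewrite addrC.
Qed.

Let mul1 : left_id (smeas_dirac 0) smeas_mul.
Proof.
move=> m; apply: smeas_eq => f bf.
rewrite !mk_smeasE//; last exact: bmeas_ev_shift.
by congr (m _); apply/funext => x; rewrite add0r.
Qed.

Let mulD : left_distributive smeas_mul smeas_add.
Proof.
move=> m n p; apply: smeas_eq => f bf; rewrite !mk_smeasE//.
exact: bmeas_ev_shift.
Qed.

Let one_neq0 : smeas_dirac 0 != 0.
Proof.
apply/eqP => /(congr1 (fun m : smeas R => m (fun=> 1))).
have b1 := @bmeas_cst _ R R 1.
by rewrite [LHS]mk_smeasE// [RHS]mk_smeasE//; exact/eqP/oner_neq0.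
Qed.

HB.instance Definition _ := GRing.Zmodule_isComNzRing.Build (smeas R)
  mulA mulC mul1 mulD one_neq0.

Lemma smeas_addE m n f : (m + n) f = m f + n f.
Proof.
have [bf|nbf] := pselect (bmeas f); first by rewrite [LHS]mk_smeasE.
by rewrite !ev_junk// addr0.
Qed.

Lemma smeas_scaleE c m f : smeas_scale c m f = c * m f.
Proof.
have [bf|nbf] := pselect (bmeas f); first by rewrite [LHS]mk_smeasE.
by rewrite !ev_junk// mulr0.
Qed.

Lemma smeas_oppE m f : (- m) f = - m f.
Proof. by rewrite [LHS]smeas_scaleE mulN1r. Qed.

Lemma smeas_subE m n f : (m - n) f = m f - n f.
Proof. by rewrite smeas_addE smeas_oppE. Qed.

Lemma smeas_0E f : (0 : smeas R) f = 0.
Proof. by rewrite -(subrr (0 : smeas R)) smeas_subE subrr. Qed.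

Lemma smeas_mulE m n f : bmeas f ->
  (m * n) f = m (fun x => n (fun y => f (x + y))).
Proof. by move=> bf; rewrite [LHS]mk_smeasE. Qed.

Lemma smeas_diracE x f : bmeas f -> smeas_dirac x f = f x.
Proof. exact: mk_smeasE. Qed.

Lemma smeas_dirac_mulE x m f : bmeas f ->
  (smeas_dirac x * m) f = m (fun y => f (x + y)).
Proof.
by move=> bf; rewrite smeas_mulE// smeas_diracE//; exact: bmeas_ev_shift.
Qed.

Lemma smeas_dirac0 : smeas_dirac 0 = 1.
Proof. by []. Qed.

Lemma smeas_diracD x y : smeas_dirac (x + y) = smeas_dirac x * smeas_dirac y.
Proof.
apply: smeas_eq => f bf; rewrite smeas_dirac_mulE//.
by rewrite !smeas_diracE//; exact: bmeas_shiftl.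
Qed.

Lemma smeas_scaleAl c m n : smeas_scale c (m * n) = smeas_scale c m * n.
Proof.
apply: smeas_eq => f bf; rewrite smeas_scaleE !smeas_mulE//.
by rewrite smeas_scaleE.
Qed.

End smeas_ring.

(** * Measures carried by the nonpositive half-line *)

Section nonpositive_support.
Context (R : realType).
Implicit Types (f g : R -> R) (m n k mu nu : smeas R).

Definition nonpos_supp m :=
  forall f, bmeas f -> (forall x, x <= 0 -> f x = 0) -> m f = 0.

Lemma nonpos_supp_eq m f g : nonpos_supp m -> bmeas f -> bmeas g ->
  (forall x, x <= 0 -> f x = g x) -> m f = m g.
Proof.
move=> m0 bf bg fg; apply/eqP; rewrite -subr_eq0 -evB//; apply/eqP/m0.
  exact: bmeasB.
by move=> x /fg ->; rewrite subrr.
Qed.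

Lemma nonpos_suppD m n : nonpos_supp m -> nonpos_supp n -> nonpos_supp (m + n).
Proof. by move=> m0 n0 f bf f0; rewrite smeas_addE m0// n0// addr0. Qed.

Lemma nonpos_suppZ c m : nonpos_supp m -> nonpos_supp (smeas_scale c m).
Proof. by move=> m0 f bf f0; rewrite smeas_scaleE m0// mulr0. Qed.

Lemma nonpos_suppB m n : nonpos_supp m -> nonpos_supp n -> nonpos_supp (m - n).
Proof. by move=> m0 n0 f bf f0; rewrite smeas_subE m0// n0// subr0. Qed.

Lemma nonpos_supp_dirac x : x <= 0 -> nonpos_supp (smeas_dirac x).
Proof. by move=> x0 f bf f0; rewrite smeas_diracE// f0. Qed.

Lemma nonpos_suppM m n : nonpos_supp m -> nonpos_supp n -> nonpos_supp (m * n).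
Proof.
move=> m0 n0 f bf f0; rewrite smeas_mulE//; apply: m0.
  exact: bmeas_ev_shift.
move=> x x0; apply: n0; first exact: bmeas_shiftl.
by move=> y y0; rewrite f0// -(addr0 0) lerD.
Qed.

Lemma nonpos_suppMn m j : nonpos_supp m -> nonpos_supp (m *+ j).
Proof.
move=> m0; elim: j => [|j IH]; last by rewrite mulrS; exact: nonpos_suppD.
by rewrite mulr0n -(subrr m); exact: nonpos_suppB.
Qed.

Lemma nonpos_supp_mulrSn m j : nonpos_supp (m *+ j.+1) -> nonpos_supp m.
Proof.
move=> m0 f bf f0; have := m0 f bf f0.
have -> : (m *+ j.+1) f = m f *+ j.+1.
  by elim: j.+1 => [|i IH]; rewrite ?smeas_0E// !mulrS smeas_addE IH.
by move/eqP; rewrite mulrn_eq0 => /orP[//|/eqP].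
Qed.

(** Induction step of the expansion below, over an abstract commutative ring: [u] stands for
    [nu ^+ i] and [c] for the numeral [i.+1]. *)
Let expansion_step (A : comNzRingType) (mu nu u r c : A) :
  mu * (nu * u + u * (mu - nu) * c + r) = nu * (nu * u) +
    nu * u * (mu - nu) * (c + 1) +
    (u * (mu - nu) * c * (mu - nu) + nu * r + r * (mu - nu)).
Proof. ring. Qed.

(* Writing [mu = nu + d], the binomial expansion of [mu ^+ n.+1] is
   [nu ^+ n.+1 + (n.+1) nu ^+ n * d] up to products of [d] with measures
   [nu ^+ j * d], [j < n]. *)
Lemma nonpos_supp_expM mu nu :
  (forall n : nat, nonpos_supp (mu ^+ n.+1 - nu ^+ n.+1)) ->
  forall n : nat, nonpos_supp (nu ^+ n * (mu - nu)).
Proof.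
move=> H; elim/ltn_ind => n IH.
have d0 : nonpos_supp (mu - nu) by have := H 0%N; rewrite !expr1.
(* The remainder [r] gathers the terms with at least two factors [mu - nu]. It is controlled after
   multiplication by [nu ^+ j] with [j + i <= n], the range within reach of the induction
   hypothesis. *)
have expand : forall i : nat, (i <= n)%N -> exists2 r,
    mu ^+ i.+1 = nu ^+ i.+1 + (nu ^+ i * (mu - nu)) *+ i.+1 + r &
    forall j : nat, (j + i <= n)%N -> nonpos_supp (nu ^+ j * r).
  elim=> [_|i IHi ltin].
    exists 0; first by rewrite !expr1 expr0 mul1r mulr1n addr0 addrC subrK.
    by move=> j _; rewrite mulr0 -(subrr (mu - nu)); exact: nonpos_suppB.
  have [r muE r0] := IHi (ltnW ltin).
  exists ((nu ^+ i * (mu - nu)) *+ i.+1 * (mu - nu) + nu * r + r * (mu - nu)).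
    rewrite exprS muE -(mulr_natr _ i.+1) -(mulr_natr _ i.+2) -(natr1 i.+1).
    rewrite !(exprS nu); exact: expansion_step.
  move=> j ji; rewrite 2!(mulrDr (nu ^+ j)).
  have -> : nu ^+ j * ((nu ^+ i * (mu - nu)) *+ i.+1 * (mu - nu)) =
      (nu ^+ (j + i) * (mu - nu)) *+ i.+1 * (mu - nu).
    by rewrite exprD !mulrnAl !mulrnAr !mulrA.
  rewrite (mulrA _ nu) -exprSr (mulrA _ r);
  apply: nonpos_suppD; first apply: nonpos_suppD.
  (* One factor [mu - nu] is paired with [nu ^+ (j + i)], where [j + i < n]; the other is carried by
     the half-line on its own. *)
  + by apply: nonpos_suppM => //; apply/nonpos_suppMn/IH; rewrite -ltnS -addnS.
  + by apply: r0; rewrite addSnnS.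
  + by apply: nonpos_suppM => //; apply: r0; rewrite (leq_trans _ ji)// leq_add2l.
(* At [i = n] all other terms are carried by the half-line, hence so is [n.+1] times the wanted
   measure. *)
have [r muE r0] := expand n (leqnn n); apply: (@nonpos_supp_mulrSn _ n).
have -> : (nu ^+ n * (mu - nu)) *+ n.+1 = mu ^+ n.+1 - nu ^+ n.+1 - r.
  by rewrite muE addrAC addrK addrAC subrr add0r.
by apply: nonpos_suppB => //; have := r0 0%N (leqnn _); rewrite expr0 mul1r.
Qed.

End nonpositive_support.

(** * Integrals against finite measures and image laws *)

Lemma bmeas_integrable d (T : measurableType d) (R : realType)
    (mu : {finite_measure set T -> \bar R}) (f : T -> R) :
  bmeas f -> mu.-integrable setT (EFin \o f).
Proof.
move=> [mf [M fM]].
apply: (le_integrable measurableT _ _ (finite_measure_integrable_cst mu M measurableT)).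
  exact/measurable_EFinP.
by move=> x _ /=; rewrite lee_fin (le_trans (fM x))// ler_norm.
Qed.

Lemma continuous_functional_Rintegral d (T : measurableType d) (R : realType)
    (mu : {finite_measure set T -> \bar R}) :
  continuous_functional (fun f : T -> R => \int[mu]_t f t)%R.
Proof.
split.
- move=> a f g bf bg; rewrite RintegralD ?RintegralZl//;
    apply: bmeas_integrable => //.
  exact: bmeasZ.
- exists (fine (mu setT)); first exact: fine_ge0.
  move=> f M bf fM; rewrite mulrC -Rintegral_cst//.
  have [mf _] := bf.
  have bn : bmeas (fun t => `|f t|).
    split; first exact: measurableT_comp.
    by exists M => t; rewrite normr_id.
  apply: (le_trans (le_normr_Rintegral measurableT (bmeas_integrable mu bf))).
  apply: le_Rintegral => //; first exact: bmeas_integrable.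
  by apply: bmeas_integrable; exact: bmeas_cst.
- move=> f_ f M bf_ fM f_f; have bf := bmeas_lim bf_ fM f_f.
  apply: fine_cvg; rewrite fineK; last first.
    by apply: integrable_fin_num => //; exact: bmeas_integrable.
  (* Constants are integrable for a finite measure, so the uniform bound [M] serves as the
     dominating function. *)
  have [|||||_ _] := @dominated_convergence _ _ _ mu _ measurableT
    (fun n => EFin \o f_ n) (EFin \o f) (EFin \o cst M); last exact.
  + by move=> n; apply/measurable_EFinP; case: (bf_ n).
  + by apply/measurable_EFinP; case: bf.
  + by apply: aeW => t _; apply: cvg_EFin; [exact: nearW|exact: f_f].
  + exact: finite_measure_integrable_cst.
  + by apply: aeW => t n _; rewrite /= lee_fin.
Qed.

Section smeas_law.
Context d (T : measurableType d) (R : realType).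
Variables (mu : {finite_measure set T -> \bar R}) (X : T -> R).
Hypothesis mX : measurable_fun setT X.

Definition smeas_law := mk_smeas (continuous_functional_comp mX
  (continuous_functional_Rintegral mu)).

Lemma smeas_lawE (f : R -> R) : bmeas f -> smeas_law f = (\int[mu]_t f (X t))%R.
Proof. exact: mk_smeasE. Qed.

Lemma smeas_law_indic (A : set R) : measurable A ->
  smeas_law \1_A = fine (mu (X @^-1` A)).
Proof.
move=> mA; rewrite smeas_lawE; last exact: bmeas_indic.
have mXA : measurable (X @^-1` A) by rewrite -[X @^-1` A]setTI; exact: mX.
by rewrite /Rintegral -[in RHS](setIT (X @^-1` A)) -integral_indic.
Qed.

Lemma smeas_law_ge0 (f : R -> R) : bmeas f -> (forall x, 0 <= f x) -> 0 <= smeas_law f.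
Proof. by move=> bf f0; rewrite smeas_lawE// Rintegral_ge0. Qed.

End smeas_law.

(** * The exponential kernel *)

Section exponential_kernel.
Context (R : realType) (s : R).
Hypothesis s_gt0 : 0 < s.
Implicit Types (f g : R -> R) (m n k : smeas R).

Definition kernel (x : R) := expR (- (s * `|x|)).

Lemma kernel_ge0 x : 0 <= kernel x. Proof. exact: expR_ge0. Qed.

Lemma kernel_le1 x : kernel x <= 1.
Proof. by rewrite -[leRHS]expR0 ler_expR oppr_le0 mulr_ge0// ltW. Qed.

Lemma kernelN x : kernel (- x) = kernel x. Proof. by rewrite /kernel normrN. Qed.

Lemma kernel0 : kernel 0 = 1.
Proof. by rewrite /kernel normr0 mulr0 oppr0 expR0. Qed.

Lemma bmeas_kernel : bmeas kernel.
Proof.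
apply: (@bmeas_ge0_le _ _ _ _ 1); last by move=> x; rewrite kernel_ge0 kernel_le1.
apply: measurableT_comp => //; apply: measurableT_comp => //.
by apply: measurable_funM => //; exact: measurable_normr.
Qed.

Lemma bmeas_kernelB : bmeas (fun z : R * R => kernel (z.1 - z.2)).
Proof.
apply: bmeas_comp bmeas_kernel _; apply: measurable_funB.
  exact: measurable_fst.
exact: measurable_snd.
Qed.

Lemma bmeas_kernelBr (x : R) : bmeas (fun y : R => kernel (x - y)).
Proof. exact: (bmeas_pair1 x bmeas_kernelB). Qed.

Definition form m n := m (fun x => n (fun y => kernel (x - y))).

Lemma bmeas_form_inner n : bmeas (fun x : R => n (fun y : R => kernel (x - y))).
Proof. exact: (bmeas_ev n bmeas_kernelB). Qed.

Lemma formC m n : form m n = form n m.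
Proof.
rewrite /form (ev_Fubini m n bmeas_kernelB) /=.
congr (n _); apply/funext => x; congr (m _); apply/funext => y.
by rewrite -kernelN opprB.
Qed.

Lemma formBl m n k : form (m - n) k = form m k - form n k.
Proof. exact: smeas_subE. Qed.

Lemma formBr m n k : form k (m - n) = form k m - form k n.
Proof. by rewrite formC formBl !(formC k). Qed.

Lemma formZl c m k : form (smeas_scale c m) k = c * form m k.
Proof. exact: smeas_scaleE. Qed.

Lemma formZr c m k : form k (smeas_scale c m) = c * form k m.
Proof. by rewrite formC formZl formC. Qed.

Lemma form_dirac x y m n : form (smeas_dirac x * m) (smeas_dirac y * n) =
  m (fun x' => n (fun y' => kernel (x - y + (x' - y')))).
Proof.
rewrite /form smeas_dirac_mulE; last exact: bmeas_form_inner.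
congr (m _); apply/funext => x'.
rewrite smeas_dirac_mulE; last exact: bmeas_kernelBr.
by congr (n _); apply/funext => y'; congr kernel; ring.
Qed.

(** Translation invariance: only the relative shift matters, so translating both arguments alike
    preserves the form. *)
Lemma form_dirac_shift x y m n :
  form (smeas_dirac x * m) (smeas_dirac y * n) = form (smeas_dirac (x - y) * m) n.
Proof. by rewrite -[n in RHS]mul1r -smeas_dirac0 !form_dirac subr0. Qed.

Lemma form_mull mu m n :
  form (mu * m) n = mu (fun x => form (smeas_dirac x * m) n).
Proof.
rewrite /form smeas_mulE; last exact: bmeas_form_inner.
congr (mu _); apply/funext => x.
by rewrite smeas_dirac_mulE//; exact: bmeas_form_inner.
Qed.

Lemma bmeas_form_dirac m n : bmeas (fun x => form (smeas_dirac x * m) n).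
Proof.
have -> : (fun x => form (smeas_dirac x * m) n) =
    fun x => m (fun y => n (fun z => kernel (x + y - z))).
  apply/funext => x; rewrite -[n]mul1r -smeas_dirac0 form_dirac.
  congr (m _); apply/funext => y; rewrite mul1r; congr (n _); apply/funext => z.
  by congr kernel; ring.
exact: bmeas_ev_shift (bmeas_form_inner n).
Qed.

Lemma form1 m : form m 1 = m kernel.
Proof.
rewrite /form -smeas_dirac0; congr (m _); apply/funext => x.
by rewrite smeas_diracE ?subr0//; exact: bmeas_kernelBr.
Qed.

(** For x <= 0 <= t one has |x - t| = |x| + t, so the kernel factors. *)
Lemma form_dirac1 (t : R) m : 0 <= t -> nonpos_supp m ->
  form (smeas_dirac (- t) * m) 1 = kernel t * form m 1.
Proof.
move=> t0 m0; rewrite !form1 smeas_dirac_mulE -?evZ; [|exact: bmeas_kernel..].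
apply: nonpos_supp_eq => //.
- by apply: bmeas_shiftl; exact: bmeas_kernel.
- by apply: bmeasZ; exact: bmeas_kernel.
move=> x x0; rewrite /kernel -expRD; congr expR.
rewrite ler0_norm ?(ger0_norm t0) ?(ler0_norm x0); last lra.
by ring.
Qed.

(** * Positivity of the form on the half-line *)

Section positivity.

(** Lebesgue measure is declared over [measurableTypeR R]; this identity map carries it to [R]. *)
Let idTR : measurableTypeR R -> R := idfun.

Let measurable_idTR : measurable_fun setT idTR.
Proof. by move=> _ A mA; rewrite setTI. Qed.

Let lam : {finite_measure set (measurableTypeR R) -> \bar R} :=
  mfrestr (f := lebesgue_measure) (measurable_itv `[0%R : R, 1%R])
    (compact_finite_measure (@segment_compact R 0 1)).

Let U := smeas_law lam measurable_idTR.

Let U_lt p : 0 <= p <= 1 -> U \1_(`]-oo, p[%classic : set R) = p.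
Proof.
move=> /andP[p0 p1]; rewrite smeas_law_indic//.
rewrite /= /mfrestr /mrestr (_ : _ `&` _ = `[0, p[%classic); last first.
  apply/seteqP; split => u /=; rewrite !in_itv/=.
    by move=> [-> /andP[-> _]].
  by move=> /andP[-> up]; rewrite up (le_trans (ltW up)).
rewrite lebesgue_measure_itv/= lte_fin; case: ltP => /= [_|p_le0].
  by rewrite subr0.
by apply/eqP; rewrite eq_le p0.
Qed.

Let q N (x : R) := \1_(`[- N%:R, 0]%classic : set R) x * expR (- (s * x)).

Let below : set (R * R) := [set z | z.2 < expR (2 * s * z.1)].

Let measurable_below : measurable below.
Proof.
have -> : below = (fun z => expR (2 * s * z.1) - z.2) @^-1` `]0, +oo[%classic.
  by apply/seteqP; split => z /=; rewrite in_itv/= andbT subr_gt0.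
rewrite -[X in measurable X]setTI.
have : measurable_fun setT (fun z : R * R => expR (2 * s * z.1) - z.2).
  apply: measurable_funB; last exact: measurable_snd.
  by apply: measurableT_comp => //; apply: measurable_funM => //; exact: measurable_fst.
by apply.
Qed.

Let bmeas_q N : bmeas (q N).
Proof.
apply: (@bmeas_ge0_le _ _ _ _ (expR (s * N%:R))) => [|x].
  apply: measurable_funM => //; apply: measurableT_comp => //.
  by apply: measurableT_comp => //; exact: measurable_funM.
rewrite /q indicE; have [|_] := boolP (_ \in _); last by rewrite mul0r lexx expR_ge0.
rewrite inE /= in_itv/= => /andP[Nx _]; rewrite mul1r expR_ge0/= ler_expR.
by rewrite -mulrN ler_pM2l// lerNl.
Qed.

(** A feature map for the kernel. For x, y <= 0, exp(-s|x - y|) = exp(-sx) exp(-sy) min(exp(2sx),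
    exp(2sy)), and the minimum of two numbers of [0, 1] is the length of the set of u in [0, 1]
    below both. The cutoff at [- N] in [q] keeps exp(-sx) bounded. *)
Let h N (z : R * R) := q N z.1 * \1_below z.

Let bmeas_h N : bmeas (h N).
Proof.
apply: bmeasM; last exact: bmeas_indic.
exact: bmeas_comp (bmeas_q N) (measurable_fst).
Qed.

Let h_form N x y : U (fun u => h N (x, u) * h N (y, u)) =
  \1_(`[- N%:R, 0]%classic : set R) x * \1_(`[- N%:R, 0]%classic : set R) y *
  kernel (x - y).
Proof.
wlog xy : x y / x <= y => [wlg|].
  have [/wlg//|/ltW/wlg H] := leP x y.
  under eq_fun do rewrite mulrC; rewrite H -(kernelN (y - x)) opprB.
  by congr (_ * _); rewrite mulrC.
have -> : (fun u => h N (x, u) * h N (y, u)) =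
    (fun u => q N x * q N y * \1_(`]-oo, expR (2 * s * x)[%classic : set R) u).
  apply/funext => u; rewrite /h /= mulrACA; congr (_ * _).
  rewrite !indicE -natrM mulnb; congr (_ %:R); congr nat_of_bool.
  apply/andP/idP; rewrite !inE /below/= ?in_itv/=; first by case.
  by move=> ux; split => //; rewrite (lt_le_trans ux)// ler_expR ler_pM2l// mulr_gt0.
rewrite evZ; last exact: bmeas_indic.
set u := U _; rewrite /q [\1__ x]indicE [\1__ y]indicE.
have [/set_mem/=|_] := boolP (x \in _); last by rewrite !mul0r.
rewrite in_itv/= => /andP[_ x0].
have [/set_mem/=|_] := boolP (y \in _); last by rewrite !(mulr0, mul0r).
rewrite in_itv/= => /andP[_ y0].
have -> : u = expR (2 * s * x).
  apply: U_lt; rewrite expR_ge0 -[leRHS]expR0 ler_expR.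
  by rewrite mulr_ge0_le0// mulr_ge0// ltW.
rewrite !mul1r -!expRD; congr expR.
by rewrite ler0_norm; [ring|lra].
Qed.

(** After truncation to [-N, 0], Fubini turns the form into the integral over u of the square of
    [H u], the integral of the feature map against [m]; then [N] tends to infinity. *)
Lemma form_ge0 m : nonpos_supp m -> 0 <= form m m.
Proof.
move=> m0; pose i N : R -> R := \1_(`[- N%:R, 0]%classic).
pose i0 : R -> R := \1_(`]-oo, 0]%classic).
have bi N : bmeas (i N) by exact: bmeas_indic.
have bi0 : bmeas i0 by exact: bmeas_indic.
have i_cvg x : i N x @[N --> \oo] --> i0 x.
  apply: cvg_near_cst; near=> N; rewrite /i /i0 !indicE; congr (_ %:R).
  congr nat_of_bool; apply/idP/idP; rewrite !inE/= !in_itv/=; first by case/andP.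
  move=> ->; rewrite andbT lerNl; near: N; exact: nbhs_infty_ger.
have i_bound N x : 0 <= i N x <= 1.
  by rewrite /i indicE; case: (_ \in _); rewrite ?lexx ?ler01.
have bF N : bmeas (fun z : R * R => i N z.1 * i N z.2 * kernel (z.1 - z.2)).
  apply: bmeasM; last exact: bmeas_kernelB.
  by apply: bmeasM; [exact: bmeas_comp (bi N) measurable_fst|
                     exact: bmeas_comp (bi N) measurable_snd].
have bF0 : bmeas (fun z : R * R => i0 z.1 * i0 z.2 * kernel (z.1 - z.2)).
  apply: bmeasM; last exact: bmeas_kernelB.
  by apply: bmeasM; [exact: bmeas_comp bi0 measurable_fst|
                     exact: bmeas_comp bi0 measurable_snd].
have F_bound N x y : `|i N x * i N y * kernel (x - y)| <= 1.
  have /andP[x0 x1] := i_bound N x; have /andP[y0 y1] := i_bound N y.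
  rewrite ger0_norm ?mulr_ge0 ?kernel_ge0//.
  by rewrite !mulr_ile1 ?mulr_ge0 ?kernel_ge0 ?kernel_le1.
have -> : form m m = m (fun x => m (fun y => i0 x * i0 y * kernel (x - y))).
  apply: nonpos_supp_eq => //; [exact: bmeas_form_inner|exact: (bmeas_ev m bF0)|].
  move=> x x0; apply: nonpos_supp_eq => //; first exact: bmeas_kernelBr.
    exact: (bmeas_pair1 x bF0).
  by move=> y y0; rewrite /i0 !indicE !mem_set ?mul1r//= in_itv.
have [C C0 mC] := ev_bound m.
have : m (fun x => m (fun y => i N x * i N y * kernel (x - y))) @[N --> \oo] -->
       m (fun x => m (fun y => i0 x * i0 y * kernel (x - y))).
  apply: (ev_cvg (M := C * 1)) => [N|N x|x]; first exact: (bmeas_ev m (bF N)).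
    by apply: mC => [|y]; [exact: (bmeas_pair1 x (bF N))|exact: F_bound].
  apply: (ev_cvg (M := 1)) => [N|N y|y]; first exact: (bmeas_pair1 x (bF N)).
    exact: F_bound.
  by apply: cvgMl; apply: cvgM; exact: i_cvg.
move/cvgr_to_ge; apply; apply: nearW => N.
pose H u := m (fun x => h N (x, u)).
have bH : bmeas H by exact: bmeas_ev2.
have : 0 <= U (fun u => H u * H u).
  by apply: smeas_law_ge0 => [|u]; [exact: bmeasM|rewrite -expr2 sqr_ge0].
congr (0 <= _).
have bhH : bmeas (fun z : R * R => h N z * H z.2).
  by apply: bmeasM => //; exact: bmeas_comp bH measurable_snd.
transitivity (U (fun u => m (fun x => h N (x, u) * H u))).
  congr (U _); apply/funext => u; rewrite {1}/H mulrC -evZ;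
    last exact: (bmeas_pair2 u (bmeas_h N)).
  by congr (m _); apply/funext => x; rewrite mulrC.
rewrite -(ev_Fubini m U bhH) /=; congr (m _); apply/funext => x.
have bhx : bmeas (fun z : R * R => h N (x, z.2) * h N z).
  apply: bmeasM => //.
  exact: (bmeas_comp (bmeas_pair1 x (bmeas_h N)) measurable_snd).
transitivity (U (fun u => m (fun y => h N (x, u) * h N (y, u)))).
  congr (U _); apply/funext => u; rewrite -evZ//.
  exact: (bmeas_pair2 u (bmeas_h N)).
rewrite -(ev_Fubini m U bhx) /=; congr (m _); apply/funext => y.
exact: h_form.
Unshelve. all: by end_near. Qed.

End positivity.

Let discriminant_le (a b c : R) : 0 <= c ->
  (forall t, 0 <= a - 2 * t * b + t ^+ 2 * c) -> b ^+ 2 <= a * c.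
Proof.
rewrite le_eqVlt => /predU1P[<-|c0] H.
  have [->|b0] := eqVneq b 0; first by rewrite expr0n mulr0.
  (* With [c = 0] the polynomial is affine in [t] and would take the value -1 here. *)
  have := H ((a + 1) / (2 * b)).
  have -> : 2 * ((a + 1) / (2 * b)) * b = a + 1 by field.
  by rewrite mulr0; lra.
have := H (b / c); have -> : a - 2 * (b / c) * b + (b / c) ^+ 2 * c = a - b ^+ 2 / c.
  by field; rewrite gt_eqF.
by rewrite subr_ge0 ler_pdivrMr.
Qed.

Let formBZ m n t : form (m - smeas_scale t n) (m - smeas_scale t n) =
  form m m - 2 * t * form m n + t ^+ 2 * form n n.
Proof. by rewrite !(formBl, formBr, formZl, formZr) (formC n m); ring. Qed.

Lemma form_CauchySchwarz m n : nonpos_supp m -> nonpos_supp n ->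
  form m n ^+ 2 <= form m m * form n n.
Proof.
move=> m0 n0; apply: discriminant_le => [|t]; first exact: form_ge0.
rewrite -formBZ; apply: form_ge0.
by apply: nonpos_suppB => //; exact: nonpos_suppZ.
Qed.

Let norm m : R := Num.sqrt (form m m).

Let form_norm m : nonpos_supp m -> form m m = norm m ^+ 2.
Proof. by move=> m0; rewrite sqr_sqrtr// form_ge0. Qed.

Let form_le_norm m n : nonpos_supp m -> nonpos_supp n ->
  `|form m n| <= norm m * norm n.
Proof.
move=> m0 n0; rewrite -ler_sqr ?nnegrE ?mulr_ge0 ?sqrtr_ge0//.
by rewrite exprMn -!form_norm// real_normK ?num_real// form_CauchySchwarz.
Qed.

Section approximate_projection.
Variable K : smeas R -> Prop.
Hypothesis K0 : K 0.
Hypothesis KD : forall k l, K k -> K l -> K (k + l).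
Hypothesis KZ : forall c k, K k -> K (smeas_scale c k).
Hypothesis K_nonpos : forall k, K k -> nonpos_supp k.

Let nonpos_supp1 : nonpos_supp (1 : smeas R).
Proof. by rewrite -smeas_dirac0; exact: nonpos_supp_dirac. Qed.

(* Near-minimizers of the distance from 1 to K spare us the completion of the
   pre-Hilbert space. *)
Lemma approximate_projection (delta : R) : 0 < delta -> exists2 v, K v &
  forall k, K k -> `|form (1 - v) k| <= delta * norm k.
Proof.
move=> d0; pose E := [set form (1 - v) (1 - v) | v in K].
have E_ge0 v : K v -> 0 <= form (1 - v) (1 - v).
  by move=> Kv; apply/form_ge0/nonpos_suppB => //; exact: K_nonpos.
have hE : has_inf E.
  by split; [exists (form (1 - 0) (1 - 0)), 0|exists 0 => _ [v Kv <-]; exact: E_ge0].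
have [_ [v Kv <-] vE] := inf_adherent (exprn_gt0 2 d0) hE.
exists v => // k Kk.
have k0 := K_nonpos Kk.
rewrite -ler_sqr ?nnegrE ?mulr_ge0 ?sqrtr_ge0 ?(ltW d0)//.
rewrite real_normK ?num_real// exprMn -form_norm//.
(* The squared distance of [v] is within delta^2 of the infimum and v + tk competes for it, so 0 <=
   delta^2 - 2t<1 - v, k> + t^2<k, k> for every t; the discriminant gives the bound. *)
apply: discriminant_le => [|t]; first exact: form_ge0.
have : inf E <= form (1 - v - smeas_scale t k) (1 - v - smeas_scale t k).
  apply: ge_inf; first by case: hE.
  by exists (v + smeas_scale t k); [apply: KD => //; exact: KZ|rewrite opprD addrA].
rewrite formBZ; move: vE.
move: (inf E) (form (1 - v) (1 - v)) => a b; lra.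
Qed.

Variable nu : smeas R.
Hypothesis K_nu : forall k, K k -> K (nu * k).
Hypothesis K_dirac : forall (t : R) k, 0 <= t -> K k -> K (smeas_dirac (- t) * k).
Variable k0 : smeas R.
Hypotheses (Kk0 : K k0) (k0_neq0 : k0 kernel != 0).

(* An approximate projection [v] of 1 onto [K] has autocorrelation close to a
   multiple of the kernel; as [nu * v] is in [K] too, correlating it with the
   left translates of [v] shows that [nu] integrates the translated kernel as
   if it were carried by the nonpositive half-line. *)
Lemma stable_kernel_translation (t : R) : 0 <= t ->
  nu (fun x => kernel (x - t)) = kernel t * nu kernel.
Proof.
move=> t0; have [C C0 nuC] := ev_bound nu.
pose D t := nu (fun x => kernel (x - t)) - kernel t * nu kernel.
pose n0 : R := norm k0; pose l : R := `|form k0 1|.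
have l0 : 0 < l by rewrite /l form1 normr_gt0.
have bkt (t' : R) : bmeas (fun x : R => kernel (x - t')).
  by under eq_fun do rewrite addrC; exact: bmeas_shiftl bmeas_kernel.
(* [n] is the norm of the approximate projection. The first estimate keeps it away from 0 as [delta]
   shrinks; the second then forces the defect [D] to be of order [delta]. *)
have main (delta : R) : 0 < delta -> exists n : R, [/\ 0 <= n, l <= (n + delta) * n0 &
    forall t : R, 0 <= t -> (n ^+ 2 - delta * n) * `|D t| <= 4 * C * (delta * n)].
  move=> d0; have [v Kv vK] := approximate_projection d0.
  pose n : R := norm v; have n_ge0 : 0 <= n by exact: sqrtr_ge0.
  pose L := form v 1; pose V x := form (smeas_dirac x * v) v.
  have v0 := K_nonpos Kv.
  have norm_shift (x : R) k : norm (smeas_dirac x * k) = norm k.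
    rewrite /norm form_dirac_shift subrr smeas_dirac0.
    by rewrite mul1r.
  (* [1 - v] is nearly orthogonal to the translate, which stays in [K] with the same norm; so [v]
     may be replaced by 1, for which [form_dirac1] is exact. *)
  have near_translate k (t' : R) : K k -> 0 <= t' ->
      `|form (smeas_dirac (- t') * k) v - kernel t' * form k 1| <= delta * norm k.
    move=> Kk t'0; rewrite -(form_dirac1 t'0 (K_nonpos Kk)) distrC -formBr formC.
    by rewrite -(norm_shift (- t')); apply: vK; exact: K_dirac.
  have VN x : V (- x) = V x.
    rewrite /V formC -[v in LHS]mul1r -smeas_dirac0 form_dirac_shift mul1r.
    by rewrite sub0r opprK.
  have V_near x : `|V x - kernel x * L| <= delta * n.
    have [x0|/ltW x0] := leP 0 x; first by rewrite -VN; exact: near_translate.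
    have := near_translate v (- x) Kv; rewrite opprK kernelN; apply => //.
    by rewrite oppr_ge0.
  have V_bound x : `|V x| <= n ^+ 2.
    (* Cauchy-Schwarz was proved on the half-line, hence the reduction to left translates. *)
    wlog x0 : x / x <= 0 => [wlg|].
      have [/wlg//|/ltW x0] := leP x 0; rewrite -VN; apply: wlg.
      by rewrite oppr_le0.
    rewrite expr2 -[X in X * _](norm_shift x); apply: form_le_norm => //.
    by apply: nonpos_suppM => //; exact: nonpos_supp_dirac.
  have bV : bmeas V by exact: bmeas_form_dirac.
  have bVt (t' : R) : bmeas (fun x : R => V (x - t')).
    by under eq_fun do rewrite addrC; exact: bmeas_shiftl bV.
  have form_nu (t' : R) : form (smeas_dirac (- t') * (nu * v)) v =
      nu (fun x => V (x - t')).
    rewrite mulrCA form_mull; congr (nu _); apply/funext => x.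
    by rewrite /V smeas_diracD mulrA.
  (* The squared norm is the double integral of V(x - y) against [nu], and [V] is at most [n ^+ 2];
     each integration costs a factor [C]. *)
  have norm_nu : norm (nu * v) <= C * n.
    have nuv0 : nonpos_supp (nu * v) by exact/K_nonpos/K_nu.
    rewrite -ler_sqr ?nnegrE ?mulr_ge0 ?sqrtr_ge0// -form_norm//.
    rewrite form_mull (le_trans (ler_norm _))// exprMn expr2 -mulrA.
    apply: (nuC) => [|x]; first exact: bmeas_form_dirac.
    rewrite formC form_mull; apply: (nuC) => [|y]; first exact: bmeas_form_dirac.
    by rewrite form_dirac_shift; exact: V_bound.
  (* First evaluation: [V] is uniformly close to [L] times the kernel, and this is integrated
     against [nu]. *)
  have nu_near (t' : R) :
      `|nu (fun x => V (x - t')) - L * nu (fun x => kernel (x - t'))|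
      <= C * (delta * n).
    rewrite -evZ// -evB//; last exact: bmeasZ.
    apply: (nuC) => [|x]; first by apply: bmeasB => //; exact: bmeasZ.
    by rewrite [L * _]mulrC.
  (* Second evaluation: [nu * v] belongs to [K], so [near_translate] applies to it. *)
  have nu_translate (t' : R) : 0 <= t' ->
      `|nu (fun x => V (x - t')) - kernel t' * form (nu * v) 1| <= C * (delta * n).
    move=> t'0; rewrite -form_nu (le_trans (near_translate _ _ (K_nu Kv) t'0))//.
    by rewrite mulrCA ler_wpM2l// ltW.
  have L_ge : n ^+ 2 - delta * n <= L.
    rewrite -form_norm//; have := vK v Kv; rewrite formBl [form 1 v]formC.
    rewrite ler_norml => /andP[+ _].
    by rewrite -/L -/n; lra.
  exists n; split => //.
  - rewrite /l mulrDl; have -> : form k0 1 = form v k0 + form (1 - v) k0.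
      by rewrite formBl [form 1 k0]formC; ring.
    rewrite (le_trans (ler_normD _ _))// lerD//; last exact: vK.
    by apply: form_le_norm => //; exact: K_nonpos.
  - move=> t' t'0; have [LD|LD] := leP (n ^+ 2 - delta * n) 0.
      rewrite (@le_trans _ _ 0)//; first by rewrite mulr_le0_ge0.
      by rewrite !mulr_ge0// ltW.
    apply: (@le_trans _ _ (`|L * D t'|)).
      rewrite normrM ler_wpM2r// (le_trans L_ge)// ler_norm//.
    have := nu_near t'; have := nu_near 0; have := nu_translate _ t'0.
    have := nu_translate 0 (lexx _).
    rewrite kernel0 mul1r.
    have -> : (fun x => kernel (x - 0)) = kernel.
      by apply/funext => x; rewrite subr0.
    rewrite /D -mulrA; move: (C * _) (form _ 1) => e M.
    move: (nu (fun x => V (x - 0))) (nu (fun x => V (x - t'))) => A0 At.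
    move: (nu kernel) (nu (fun x => kernel (x - t'))) => N0 Nt H1 H2 H3 H4.
    have [k0' k1'] := (kernel_ge0 t', kernel_le1 t').
    have kM (a : R) : `|a| <= e -> `|kernel t' * a| <= e.
      move=> ae; rewrite normrM ger0_norm// (le_trans _ ae)//.
      by rewrite ler_piMl.
    move: H1 H3 => /kM H1 /kM H3.
    (* The two evaluations, at [t'] and at 0, leave four errors of size at most [e]; hence the
       constant 4 in [main]. *)
    have -> : L * (Nt - kernel t' * N0) = - (At - L * Nt) +
      (At - kernel t' * M) - kernel t' * (A0 - M) + kernel t' * (A0 - L * N0) by ring.
    move: H1 H2 H3 H4; rewrite !ler_norml => /andP[? ?] /andP[? ?] /andP[? ?].
    by move=> /andP[? ?]; apply/andP; split; lra.
apply/eqP; rewrite -subr_eq0 -/(D t) -normr_eq0; apply: contraT => D_neq0.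
have {D_neq0} D_gt0 : 0 < `|D t| by rewrite lt_neqAle eq_sym D_neq0 normr_ge0.
exfalso.
have n0_gt0 : 0 < n0.
  rewrite lt_neqAle sqrtr_ge0 andbT; apply/negP => /eqP n00.
  have [n [_ + _]] := main 1 ltr01; rewrite -n00 mulr0 => /lt_le_trans.
  by move=> /(_ _ l0); rewrite ltxx.
pose rho := l / n0; have rho0 : 0 < rho by rewrite divr_gt0.
(* [rho] bounds [n + delta] from below, so [main] will give rho |D| <= delta (4C + 2|D|). This
   [delta] makes the right-hand side equal to rho |D| / 2, a contradiction. *)
pose delta := rho * `|D t| / (2 * (4 * C + 2 * `|D t|)).
have den : 0 < 4 * C + 2 * `|D t| by lra.
have deltaE : delta * (4 * C + 2 * `|D t|) = rho * `|D t| / 2.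
  by rewrite /delta; field; rewrite gt_eqF.
have d0 : 0 < delta by apply: divr_gt0; apply: mulr_gt0 => //; lra.
have [n [n_ge0 ln /(_ t t0)]] := main delta d0.
have {}ln : rho <= n + delta by rewrite ler_pdivrMr.
have d_le : delta <= rho / 4.
  rewrite -(ler_pM2r D_gt0); move: deltaE d0 C0 D_gt0.
  move: `|D t| => E dE d0 C0 E0.
  have : 0 <= delta * C by rewrite mulr_ge0// ltW.
  lra.
have n_gt0 : 0 < n by lra.
have -> : (n ^+ 2 - delta * n) * `|D t| = ((n - delta) * `|D t|) * n by ring.
have -> : 4 * C * (delta * n) = 4 * C * delta * n by ring.
rewrite ler_pM2r// => H.
have : (rho - 2 * delta) * `|D t| <= 4 * C * delta.
  by apply: le_trans H; rewrite ler_wpM2r//; lra.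
have : 0 < rho * `|D t| by rewrite mulr_gt0.
move: deltaE; lra.
Qed.

End approximate_projection.

End exponential_kernel.

(** * Uniqueness *)

Section half_line.
Context (R : realType).
Implicit Types (f : R -> R) (m nu d : smeas R).

Lemma setI_closed_open_rays : setI_closed (@RGenOInfty.G R).
Proof.
move=> _ _ [x ->] [y ->]; exists (Num.max x y); apply/seteqP.
split => z /=; rewrite !in_itv/= !andbT gt_max; first by move=> [-> ->].
by move=> /andP[].
Qed.

Lemma setI_closed_closed_rays : setI_closed (@RGenCInfty.G R).
Proof.
move=> _ _ [x ->] [y ->]; exists (Num.max x y); apply/seteqP.
split => z /=; rewrite !in_itv/= !andbT ge_max; first by move=> [-> ->].
by move=> /andP[].
Qed.

(** The integral of [psi u], that is exp(su - s|x - u|), does not depend on u >= 0. A difference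
    quotient in u tends to exp(-sx) on (t, +oo) and to 0 elsewhere, so [nu] weighted by exp(-sx)
    vanishes on every ray (t, +oo) with t >= 0. Removing the weight gives the claim. *)
Lemma nonpos_supp_kernel_translation (s : R) nu : 0 < s ->
  (forall t : R, 0 <= t ->
    nu (fun x => kernel s (x - t)) = kernel s t * nu (kernel s)) ->
  nonpos_supp nu.
Proof.
move=> s0 nu_ker.
pose w (t x : R) := \1_(`]t, +oo[%classic : set R) x * expR (- (s * x)).
have w_bound (t x : R) : 0 <= t -> 0 <= w t x <= 1.
  move=> t0; rewrite /w indicE; have [|_] := boolP (_ \in _); last first.
    by rewrite mul0r lexx ler01.
  move=> /set_mem/=; rewrite in_itv/= andbT => tx; rewrite mul1r expR_ge0/=.
  by rewrite -[leRHS]expR0 ler_expR oppr_le0 mulr_ge0// ltW// (le_lt_trans t0).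
have bw (t : R) : 0 <= t -> bmeas (w t).
  move=> t0; apply: (@bmeas_ge0_le _ _ _ _ 1) => [|x]; last exact: w_bound.
  apply: measurable_funM => //; apply: measurableT_comp => //.
  by apply: measurableT_comp => //; exact: measurable_funM.
have nu_w (t : R) : 0 <= t -> nu (w t) = 0.
  move=> t0; pose psi (u x : R) := expR (s * u) * kernel s (x - u).
  (* Dividing by the increment of exp(2su), not of u, makes the quotient exactly exp(-sx) to the
     right of both points. *)
  pose del (n : nat) : R := expR (2 * s * (t + n.+1%:R^-1)) - expR (2 * s * t).
  have del0 n : 0 < del n.
    by rewrite subr_gt0 ltr_expR ltr_pM2l ?mulr_gt0// ltrDl invr_gt0.
  pose g n x := (del n)^-1 * (psi (t + n.+1%:R^-1) x - psi t x).
  have bpsi u : bmeas (psi u).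
    apply: bmeasZ; under eq_fun do rewrite addrC.
    exact: bmeas_shiftl (bmeas_kernel s0).
  have nu_psi (u : R) : 0 <= u -> nu (psi u) = nu (kernel s).
    move=> u0; rewrite evZ; last first.
      by under eq_fun do rewrite addrC; exact: bmeas_shiftl (bmeas_kernel s0).
    rewrite nu_ker// mulrA /kernel (ger0_norm u0) -expRD subrr expR0.
    by rewrite mul1r.
  have psi_le u x : x <= u -> psi u x = expR (s * x).
    move=> xu; rewrite /psi /kernel -expRD; congr expR.
    by rewrite ler0_norm; [ring|lra].
  have psi_ge u x : u <= x -> psi u x = expR (2 * s * u) * expR (- (s * x)).
    move=> xu; rewrite /psi /kernel -!expRD; congr expR.
    by rewrite ger0_norm; [ring|lra].
  have g_le n (x : R) : x <= t -> g n x = 0.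
    move=> xt; rewrite /g !psi_le ?subrr ?mulr0//.
    by rewrite (le_trans xt)// lerDl.
  have g_ge n (x : R) : t + n.+1%:R^-1 <= x -> g n x = expR (- (s * x)).
    move=> tx; rewrite /g !psi_ge//; last by rewrite (le_trans _ tx)// lerDl.
    by rewrite -mulrBl mulrA mulVf ?mul1r// gt_eqF.
  have g_bound n x : `|g n x| <= 1.
    have [xt|/ltW tx] := leP x t; first by rewrite g_le// normr0.
    have ex : expR (- (s * x)) <= 1.
      rewrite -[leRHS]expR0 ler_expR oppr_le0 mulr_ge0//; first exact: ltW.
      exact: le_trans tx.
    have [ux|/ltW xu] := leP (t + n.+1%:R^-1) x.
      by rewrite g_ge// ger0_norm// expR_ge0.
    (* Between the two points the quotient is (exp(2sx) - exp(2st)) / [del n] times exp(-sx), and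
       both factors lie in [0, 1]. *)
    have e2 : expR (s * x) = expR (2 * s * x) * expR (- (s * x)).
      by rewrite -expRD; congr expR; ring.
    rewrite /g (psi_le _ _ xu) (psi_ge _ _ tx) e2 -mulrBl mulrA normrM.
    rewrite (ger0_norm (expR_ge0 _)) mulr_ile1// ?expR_ge0//.
    rewrite ger0_norm; last first.
      rewrite mulr_ge0// ?invr_ge0 ?(ltW (del0 n))// subr_ge0 ler_expR ler_pM2l//.
      exact: mulr_gt0.
    rewrite mulrC ler_pdivrMr// mul1r lerD2r ler_expR ler_pM2l//.
    exact: mulr_gt0.
  have bg n : bmeas (g n) by apply/bmeasZ/bmeasB.
  have g_cvg x : g n x @[n --> \oo] --> w t x.
    rewrite /w indicE; have [|] := boolP (_ \in _); last first.
      move=> /negP tx; rewrite mul0r; apply: cvg_near_cst; apply: nearW => n.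
      apply: g_le; rewrite leNgt; apply/negP => tx'; apply: tx.
      by rewrite inE/= in_itv/= tx'.
    move=> /set_mem/=; rewrite in_itv/= andbT -subr_gt0 => tx.
    rewrite mul1r; apply: cvg_near_cst; near=> n; apply: g_ge.
    rewrite -lerBrDl ltW//; near: n; exact: near_infty_natSinv_lt (PosNum tx).
  have := @ev_cvg _ nu _ _ _ bg g_bound g_cvg.
  have -> : (fun n => nu (g n)) = fun=> 0.
    apply/funext => n; rewrite evZ; last exact: bmeasB.
    by rewrite evB// !nu_psi// ?subrr ?mulr0// addr_ge0.
  by move=> /(cvg_unique _ (cvg_cst 0)) <-.
have bw0 := bw 0 (lexx 0).
(* The weighted measure vanishes on a generating family of rays, since cutting [w 0] to the ray
   beyond [t] gives [w (Num.max 0 t)]. *)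
have nu_fw f : bmeas f -> nu (fun x => f x * w 0 x) = 0.
  apply: (continuous_functional_eq (phi := fun f => nu (fun x => f x * w 0 x))
    (psi := fun=> 0) (RGenOInfty.measurableE R) setI_closed_open_rays
    (continuous_functional_mul bw0 (ev_continuous_functional nu))
    (@continuous_functional0 _ R R)) => [_ [t ->]|].
  - transitivity (nu (w (Num.max 0 t))); last first.
      by apply: nu_w; rewrite le_max lexx.
    congr (nu _); apply/funext => x; rewrite /w mulrA !indicE -natrM mulnb.
    congr ((nat_of_bool _)%:R * _).
    apply/andP/idP; rewrite !inE/= !in_itv/= !andbT gt_max; last by move=> /andP[].
    by move=> [-> ->].
  - rewrite -[RHS](nu_w 0 (lexx 0)); congr (nu _).
    by apply/funext => x; rewrite mul1r.
move=> f bf f0; have [_ [M fM]] := bf.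
(* The inverse of the weight, truncated at [n] to remain bounded. *)
pose e n x := \1_(`]-oo, n%:R]%classic : set R) x * expR (s * x).
have be n : bmeas (e n).
  apply: (@bmeas_ge0_le _ _ _ _ (expR (s * n%:R))) => [|x].
    by apply: measurable_funM => //; apply: measurableT_comp.
  rewrite /e indicE; have [|_] := boolP (_ \in _); last by rewrite mul0r lexx expR_ge0.
  move=> /set_mem/=; rewrite in_itv/= => xn.
  by rewrite mul1r expR_ge0 ler_expR ler_pM2l.
have ew n x : 0 < x -> e n x * w 0 x = \1_(`]-oo, n%:R]%classic : set R) x.
  move=> x0; rewrite /e /w [X in _ * (X * _)]indicE mem_set/= ?in_itv/= ?x0//.
  by rewrite mul1r -mulrA -expRD subrr expR0 mulr1.
have few n x : f x * e n x * w 0 x = f x * \1_(`]-oo, n%:R]%classic : set R) x.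
  have [/f0 ->|x0] := leP x 0; first by rewrite !mul0r.
  by rewrite -mulrA ew.
have : nu (fun x => f x * e n x * w 0 x) @[n --> \oo] --> nu f.
  apply: (ev_cvg (M := M)) => [n|n x|x].
  - by apply: bmeasM => //; exact: bmeasM.
  - rewrite few normrM (le_trans _ (fM x))// ler_piMr// indicE.
    by case: (_ \in _); rewrite ?normr0 ?normr1.
  - under eq_fun do rewrite few.
    apply: cvg_near_cst; near=> n.
    by rewrite indicE mem_set ?mulr1//= in_itv/=; near: n; exact: nbhs_infty_ger.
have -> : (fun n => nu (fun x => f x * e n x * w 0 x)) = fun=> 0.
  by apply/funext => n; apply: nu_fw; exact: bmeasM.
by move=> /(cvg_unique _ (cvg_cst 0)) <-.
Unshelve. all: by end_near. Qed.

(** * Uniqueness of the Laplace transform *)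

Let expr1B_ge (a : R) N : 0 <= a <= 1 -> 1 - N%:R * a <= (1 - a) ^+ N.
Proof.
move=> /andP[a0 a1]; elim: N => [|N IH]; first by rewrite mul0r subr0.
rewrite exprSr; apply: (@le_trans _ _ ((1 - N%:R * a) * (1 - a))).
  have : 0 <= N%:R * a ^+ 2 by rewrite mulr_ge0 ?sqr_ge0.
  by rewrite -natr1; lra.
by rewrite ler_wpM2r// subr_ge0.
Qed.

(** Companion of Bernoulli's inequality, by induction from (1 - a)(1 + (N + 1)a) <= 1 + Na. *)
Let expr1B_le (a : R) N : 0 <= a <= 1 -> (1 - a) ^+ N <= (1 + N%:R * a)^-1.
Proof.
move=> /andP[a0 a1]; rewrite -[leRHS]mul1r ler_pdivlMr; last first.
  by rewrite ltr_pwDl// mulr_ge0.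
elim: N => [|N IH]; first by rewrite mul0r addr0 mulr1.
apply: le_trans IH; rewrite exprSr -mulrA ler_wpM2l ?exprn_ge0 ?subr_ge0//.
have : 0 <= N%:R * a ^+ 2 by rewrite mulr_ge0 ?sqr_ge0.
by have := sqr_ge0 a; rewrite -natr1; lra.
Qed.

(* [(1 - exp (- n^2 |x|)) ^ N] with [N] close to [exp (n^2 c + n)] tends to the
   indicator function of [|x| > c]. *)
Let step (c : R) n (x : R) : R :=
  (1 - kernel (n%:R ^+ 2) x) ^+ (Num.truncn (expR (n%:R ^+ 2 * c + n%:R))).+1.

Let kernel01 (r x : R) : 0 <= r -> 0 <= kernel r x <= 1.
Proof.
move=> r0; rewrite expR_ge0 -[leRHS]expR0 ler_expR oppr_le0.
by rewrite mulr_ge0.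
Qed.

Let step01 c n x : 0 <= step c n x <= 1.
Proof.
have /andP[k0 k1] := kernel01 x (sqr_ge0 n%:R).
by rewrite exprn_ge0 ?exprn_ile1 ?subr_ge0// lerBlDr lerDl.
Qed.

Let invSn_cvg0 : (n.+1%:R^-1 : R) @[n --> \oo] --> (0 : R).
Proof. exact: cvg_harmonic. Qed.

Let over (c x : R) : R := (c < `|x|)%R%:R.

(** By the two Bernoulli bounds the limit depends on the exponent times the kernel, comparable to
    exp(n^2 (c - |x|) + n). It tends to 0 if |x| > c and to infinity otherwise; the summand n
    settles the case |x| = c. *)
Let step_cvg c x : 0 <= c -> step c n x @[n --> \oo] --> over c x.
Proof.
move=> c0; pose E n : R := expR (n%:R ^+ 2 * c + n%:R).
have EN n : E n <= (Num.truncn (E n)).+1%:R by exact/ltW/truncnS_gt.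
have NE n : (Num.truncn (E n)).+1%:R <= 2 * E n.
  have E1 : 1 <= E n.
    by rewrite -[leLHS]expR0 ler_expR addr_ge0// mulr_ge0// sqr_ge0.
  by rewrite -natr1 mulrDl mul1r lerD// truncn_le expR_ge0.
have Ek n : E n * kernel (n%:R ^+ 2) x = expR (n%:R ^+ 2 * (c - `|x|) + n%:R).
  by rewrite -expRD; congr expR; ring.
rewrite /over; have [cx|xc] := ltP c `|x|.
  apply: (@squeeze_cvgr _ _ _ _ (fun n => 1 - 2 * n.+1%:R^-1) (fun=> 1)).
  - near=> n; have /andP[_ ->] := step01 c n x; rewrite andbT.
    apply: le_trans (expr1B_ge _ (kernel01 x (sqr_ge0 n%:R))).
    rewrite lerD2l lerN2 (@le_trans _ _ (2 * E n * kernel (n%:R ^+ 2) x))//.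
      by apply: ler_wpM2r; [exact: expR_ge0|exact: NE].
    rewrite -mulrA Ek ler_pM2l// (@le_trans _ _ (expR (- n%:R)))//.
      (* From here on n^2 (|x| - c) >= 2n, which leaves an exponent of at most -n. *)
      have : 2 / (`|x| - c) <= n%:R by near: n; exact: nbhs_infty_ger.
      rewrite ler_pdivrMr ?subr_gt0// => H; rewrite ler_expR.
      have := ler_wpM2l (ler0n R n) H.
      by rewrite expr2; lra.
    rewrite expRN lef_pV2 ?posrE ?expR_gt0//.
    by rewrite -nat1r expR_ge1Dx.
  - rewrite -[X in _ --> X]subr0 -[X in _ - X](mulr0 2).
    by apply: cvgB; [exact: cvg_cst|apply: cvgMr; exact: invSn_cvg0].
  - exact: cvg_cst.
apply: (@squeeze_cvgr _ _ _ _ (fun=> 0) (fun n => n.+1%:R^-1)) => //;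
  last exact: cvg_cst.
apply: nearW => n; have /andP[-> _] /= := step01 c n x.
apply: (le_trans (expr1B_le _ (kernel01 x (sqr_ge0 n%:R)))).
have N0 : 0 <= (Num.truncn (E n)).+1%:R * kernel (n%:R ^+ 2) x.
  by rewrite mulr_ge0// expR_ge0.
rewrite lef_pV2 ?posrE//; last by rewrite ltr_pwDl.
rewrite -nat1r lerD2l (@le_trans _ _ (E n * kernel (n%:R ^+ 2) x))//; last first.
  by apply: ler_wpM2r; [exact: expR_ge0|exact: EN].
rewrite Ek (@le_trans _ _ (expR n%:R))//; last first.
  rewrite ler_expR lerDr mulr_ge0 ?sqr_ge0 ?subr_ge0//.
by rewrite (le_trans _ (expR_ge1Dx _))// lerDr.
Unshelve. all: by end_near. Qed.

(** Kernels multiply by adding their parameters, so [d] kills all polynomials in a kernel, in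
    particular the functions [step c n] and their limits [over c]. On (-oo, 0] these limits are
    indicators of rays, which determine [d]. *)
Lemma laplace_unique d : nonpos_supp d ->
  (forall s : R, 0 < s -> d (kernel s) = 0) -> d = 0.
Proof.
move=> d0 dL.
have k0 : kernel (0 : R) = fun=> 1.
  by apply/funext => x; rewrite /kernel mul0r oppr0 expR0.
have bk (s : R) : 0 <= s -> bmeas (kernel s).
  rewrite le_eqVlt => /predU1P[<-|]; last exact: bmeas_kernel.
  by rewrite k0; exact: bmeas_cst.
(* The total mass is the limit of the transform as s tends to 0. *)
have d1 : d (fun=> 1) = 0.
  have : d (kernel n.+1%:R^-1) @[n --> \oo] --> d (fun=> 1).
    apply: (ev_cvg (M := 1)) => [n|n x|x].
    - by apply: bk; rewrite invr_ge0.
    - have n0 : 0 <= n.+1%:R^-1 :> R by rewrite invr_ge0.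
      by have /andP[? ?] := kernel01 x n0; rewrite ger0_norm.
    - suff : kernel n.+1%:R^-1 x @[n --> \oo] --> kernel (0 : R) x by rewrite k0.
      apply: continuous_cvg; first exact: continuous_expR.
      by apply: cvgN; apply: cvgMl; exact: invSn_cvg0.
  by under eq_fun do rewrite dL ?invr_gt0//; move=> /(cvg_unique _ (cvg_cst 0)) <-.
have {}dL (s : R) : 0 <= s -> d (kernel s) = 0.
  by rewrite le_eqVlt => /predU1P[<-|/dL//]; rewrite k0.
have b1k (r : R) N : 0 <= r -> bmeas (fun x => (1 - kernel r x) ^+ N).
  move=> r0; elim: N => [|N IH]; first exact: bmeas_cst.
  under [X in bmeas X]eq_fun do rewrite exprS.
  by apply: bmeasM => //; apply: bmeasB; [exact: bmeas_cst|exact: bk].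
have dk (s r : R) N : 0 <= s -> 0 <= r ->
    d (fun x => kernel s x * (1 - kernel r x) ^+ N) = 0.
  move=> + r0; elim: N s => [|N IH] s s0.
    by under eq_fun do rewrite mulr1; exact: dL.
  have -> : (fun x => kernel s x * (1 - kernel r x) ^+ N.+1) =
      fun x => kernel s x * (1 - kernel r x) ^+ N -
               kernel (s + r) x * (1 - kernel r x) ^+ N.
    apply/funext => x; rewrite exprS.
    have -> : kernel (s + r) x = kernel s x * kernel r x.
      by rewrite /kernel -expRD; congr expR; ring.
    by ring.
  have sr : 0 <= s + r by exact: addr_ge0.
  by rewrite evB ?IH ?subrr//; apply: bmeasM;
    [exact: bk|exact: b1k|exact: bk|exact: b1k].
have bi (c : R) : 0 <= c -> bmeas (over c).
  move=> c0; apply: (bmeas_lim (M := 1) _ _ (fun x => @step_cvg c x c0)).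
    by move=> n; apply: b1k; exact: sqr_ge0.
  by move=> n x; have /andP[? ?] := step01 c n x; rewrite ger0_norm.
have di (c : R) : 0 <= c -> d (over c) = 0.
  move=> c0; have : d (step c n) @[n --> \oo] --> d (over c).
    apply: (ev_cvg (M := 1)) => [n|n x|]; last by move=> x; exact: step_cvg.
      by apply: b1k; exact: sqr_ge0.
    by have /andP[? ?] := step01 c n x; rewrite ger0_norm.
  have dstep n : d (step c n) = 0.
    have := dk 0 _ (Num.truncn (expR (n%:R ^+ 2 * c + n%:R))).+1
      (lexx 0) (sqr_ge0 n%:R).
    by rewrite k0; under eq_fun do rewrite mul1r.
  by under eq_fun do rewrite dstep; move=> /(cvg_unique _ (cvg_cst 0)) <-.
apply: smeas_eq => f; rewrite smeas_0E.
apply: (continuous_functional_eq (phi := ev d) (psi := fun=> 0)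
  (RGenCInfty.measurableE R) setI_closed_closed_rays (ev_continuous_functional d)
  (@continuous_functional0 _ R R)) => // _ [t ->].
have bt : bmeas (\1_(`[t, +oo[%classic) : R -> R) by exact: bmeas_indic.
  (* A ray starting beyond 0 has no mass. Otherwise, within (-oo, 0], its complement is the set
     where |x| > -t. *)
  have [t0|t0] := ltP 0 t.
    apply: d0 => // x x0; rewrite indicE memNset//= in_itv/= andbT.
    by apply/negP; rewrite -ltNge (le_lt_trans x0).
  have b1 := @bmeas_cst _ R R 1.
  have nt0 : 0 <= - t by rewrite oppr_ge0.
  have bo := bi _ nt0.
  rewrite (@nonpos_supp_eq _ _ _ (fun x => 1 - over (- t) x) d0) ?evB ?d1 ?di ?subrr//.
    exact: bmeasB.
  move=> x x0; rewrite /over indicE ler0_norm// ltrN2.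
  have [xt|tx] := ltP x t.
    by rewrite subrr memNset//= in_itv/= andbT; apply/negP; rewrite -ltNge.
  by rewrite subr0 mem_set//= in_itv/= andbT.
Qed.

Lemma smeas_eq_of_pos_powers mu nu :
  (forall n : nat, nonpos_supp (mu ^+ n.+1 - nu ^+ n.+1)) ->
  ~ nonpos_supp nu -> mu = nu.
Proof.
move=> H nu_pos; apply: contrapT => mu_neq_nu.
have d0 : nonpos_supp (mu - nu) by have := H 0%N; rewrite !expr1.
have [s s0 Ls] : exists2 s : R, 0 < s & (mu - nu) (kernel s) != 0.
  apply: contrapT => nL; apply: mu_neq_nu; apply: subr0_eq.
  apply: laplace_unique => // s s0; apply: contrapT => /eqP Ls.
  by apply: nL; exists s.
apply: nu_pos; apply: (nonpos_supp_kernel_translation s0).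
(* Quantifying over all powers builds stability under [nu] into [K]; the power 0 returns the
   half-line condition. *)
pose K k := forall n : nat, nonpos_supp (nu ^+ n * k).
apply: (@stable_kernel_translation _ _ s0 K) Ls.
- by move=> n; rewrite mulr0 -(subrr (mu - nu)); exact: nonpos_suppB.
- by move=> k l Kk Kl n; rewrite mulrDr; exact: nonpos_suppD.
- move=> c k Kk n; rewrite mulrC -smeas_scaleAl mulrC.
  exact: nonpos_suppZ.
- by move=> k /(_ 0%N); rewrite expr0 mul1r.
- by move=> k Kk n; rewrite mulrA -exprSr.
- move=> t k t0 Kk n; rewrite mulrCA; apply: nonpos_suppM => //.
  by apply: nonpos_supp_dirac; rewrite oppr_le0.
- exact: nonpos_supp_expM.
Qed.

End half_line.

(** * Charges *)

Section smeas_of_charge.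
Context (R : realType).
Implicit Types (mu nu : {charge set R -> \bar R}) (m n : smeas R).

Lemma smeas_eq_indic m n : (forall A, measurable A -> m \1_A = n \1_A) -> m = n.
Proof.
move=> mn; apply: smeas_eq; apply: (continuous_functional_eq
  (phi := ev m) (psi := ev n) (RGenOInfty.measurableE R) (@setI_closed_open_rays R)
  (ev_continuous_functional m) (ev_continuous_functional n)).
- by move=> _ [t ->]; exact: mn.
- by have := mn _ measurableT; rewrite indicT.
Qed.

Definition smeas_of_charge mu : smeas R :=
  smeas_law (charge_pos mu) (@measurable_id _ R setT) -
  smeas_law (charge_neg mu) (@measurable_id _ R setT).

Lemma smeas_of_charge_indic mu A : measurable A ->
  smeas_of_charge mu \1_A = fine (mu A).
Proof.
move=> mA; rewrite smeas_subE !smeas_law_indic//.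
have -> : mu A = (charge_pos mu A - charge_neg mu A)%E.
  rewrite [LHS](jordan_decomp (svalP (cid (svalP (cid (Hahn_decomposition mu))))) mA).
  by rewrite /cadd/= cscaleN1.
by rewrite fineB// fin_num_measure.
Qed.

Lemma smeas_of_charge_eq_on mu nu : smeas_of_charge mu = smeas_of_charge nu ->
  eq_on_measurable mu nu.
Proof.
move=> munu A mA; rewrite -(fineK (fin_num_measure mu _ mA)).
by rewrite -(fineK (fin_num_measure nu _ mA)) -!smeas_of_charge_indic// munu.
Qed.

Let fineDDB (a b c e : \bar R) : a \is a fin_num -> b \is a fin_num ->
  c \is a fin_num -> e \is a fin_num ->
  fine (a + b - (c + e))%E = fine a + fine b - (fine c + fine e).
Proof. by case: a b c e => [a| |] [b| |] [c| |] [e| |]. Qed.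

(** The product measure integrates the masses of sections, and the section at [x] of the preimage of
    [A] under addition is [A] translated by [- x]. *)
Let finite_product_shift (p q : {finite_measure set R -> \bar R}) A :
  measurable A -> fine (finite_product p q ((fun z : R * R => z.1 + z.2) @^-1` A)) =
  (smeas_law p (@measurable_id _ R setT) * smeas_law q (@measurable_id _ R setT)) \1_A.
Proof.
move=> mA; have bA := bmeas_indic R mA.
rewrite smeas_mulE// smeas_lawE; last exact: bmeas_ev_shift.
congr fine; apply: eq_integral => x _.
set B := xsection ((fun z : R * R => z.1 + z.2) @^-1` A) x.
have mB : measurable B.
  apply: measurable_xsection; rewrite -[X in measurable X]setTI.
  exact: measurable_funD.
have -> : (fun y => \1_A (x + y)) = \1_B :> (R -> R).
  by apply/funext => y; rewrite !indicE mem_xsection.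
by rewrite smeas_law_indic// fineK// fin_num_measure.
Qed.

Lemma smeas_of_convolution mu nu :
  smeas_of_charge (convolution mu nu) = smeas_of_charge mu * smeas_of_charge nu.
Proof.
apply: smeas_eq_indic => A mA; rewrite smeas_of_charge_indic//.
(* The product is expanded to match the four terms of [charge_product]. *)
have -> : smeas_of_charge mu * smeas_of_charge nu =
  smeas_law (charge_pos mu) (@measurable_id _ R setT) *
    smeas_law (charge_pos nu) (@measurable_id _ R setT) +
  smeas_law (charge_neg mu) (@measurable_id _ R setT) *
    smeas_law (charge_neg nu) (@measurable_id _ R setT) -
  (smeas_law (charge_pos mu) (@measurable_id _ R setT) *
    smeas_law (charge_neg nu) (@measurable_id _ R setT) +
   smeas_law (charge_neg mu) (@measurable_id _ R setT) *
    smeas_law (charge_pos nu) (@measurable_id _ R setT)).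
  rewrite /smeas_of_charge.
  move: (smeas_law (charge_pos mu) _) (smeas_law (charge_neg mu) _).
  move: (smeas_law (charge_pos nu) _) (smeas_law (charge_neg nu) _) => a b c d.
  ring.
rewrite smeas_subE !smeas_addE -!finite_product_shift//.
set B := _ @^-1` A.
have mB : measurable B by rewrite -[B]setTI; exact: measurable_funD.
have fin (p q : {finite_measure set R -> \bar R}) :
    finite_product p q B \is a fin_num by exact: fin_num_measure.
transitivity (fine (
   finite_product (charge_pos mu) (charge_pos nu) B +
   finite_product (charge_neg mu) (charge_neg nu) B -
   (finite_product (charge_pos mu) (charge_neg nu) B +
    finite_product (charge_neg mu) (charge_pos nu) B))%E); first by [].
by apply: fineDDB; exact: fin.
Qed.

Lemma smeas_of_convolution_pow mu (n : nat) :
  smeas_of_charge (convolution_pow mu n.+1) = smeas_of_charge mu ^+ n.+1.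
Proof.
rewrite /convolution_pow iteropS; elim: n => [|n IH]; first by rewrite expr1.
by rewrite iterS smeas_of_convolution IH [RHS]exprS.
Qed.

Let pos : set R := `]0, +oo[%classic.

Lemma pos_restrE mu A : measurable A -> pos_restr mu A = mu (A `&` pos).
Proof. by move=> mA; rewrite /pos_restr /= /crestr0 mem_set. Qed.

(** Passage between test functions and sets: the measure cut to (0, +oo) is a continuous functional,
    hence zero as soon as it vanishes on rays and on 1. *)
Lemma nonpos_suppP m : nonpos_supp m <->
  forall A, measurable A -> m \1_(A `&` pos) = 0.
Proof.
have mpos : measurable pos by exact: measurable_itv.
split=> [m0 A mA|m0 f bf f0].
  apply: m0 => [|x x0]; first by apply: bmeas_indic; exact: measurableI.
  by rewrite indicE memNset// => -[_]; rewrite /pos/= in_itv/= andbT ltNge x0.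
have -> : f = fun x => f x * \1_pos x.
  apply/funext => x; have [/f0 ->|x0] := leP x 0; first by rewrite mul0r.
  by rewrite indicE mem_set ?mulr1// /pos/= in_itv/= x0.
have bpos := bmeas_indic R mpos.
apply: (continuous_functional_eq (phi := fun f => m (fun x => f x * \1_pos x))
  (psi := fun=> 0) (RGenOInfty.measurableE R) (@setI_closed_open_rays R)
  (continuous_functional_mul bpos (ev_continuous_functional m))
  (@continuous_functional0 _ R R)) => // [_ [t ->]|].
- rewrite -[RHS](m0 `]t, +oo[%classic)//; congr (m _); apply/funext => x.
  by rewrite !indicE in_setI -natrM mulnb.
- rewrite -[RHS](m0 setT)// setTI; congr (m _); apply/funext => x.
  by rewrite mul1r.
Qed.

Lemma nonpos_supp_of_charge_sub mu nu :
  eq_on_measurable (pos_restr mu) (pos_restr nu) ->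
  nonpos_supp (smeas_of_charge mu - smeas_of_charge nu).
Proof.
move=> munu; apply/nonpos_suppP => A mA.
have mAp : measurable (A `&` pos) by apply: measurableI => //; exact: measurable_itv.
rewrite smeas_subE !smeas_of_charge_indic//.
by rewrite -!pos_restrE// munu// subrr.
Qed.

Lemma nondegenerate_smeas nu : nondegenerate_charge nu ->
  ~ nonpos_supp (smeas_of_charge nu).
Proof.
move=> nu_pos /nonpos_suppP nu0; apply: nu_pos => A mA.
have mAp : measurable (A `&` pos) by apply: measurableI => //; exact: measurable_itv.
rewrite pos_restrE// -(fineK (fin_num_measure nu _ mAp)).
by rewrite -smeas_of_charge_indic// nu0.
Qed.

Lemma charge_eq_of_pos_convolution_pow mu nu : nondegenerate_charge nu ->
  (forall n : nat, (0 < n)%N -> eq_on_measurable (pos_restr (convolution_pow mu n))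
                                           (pos_restr (convolution_pow nu n))) ->
  eq_on_measurable mu nu.
Proof.
move=> /nondegenerate_smeas nu_pos munu; apply/smeas_of_charge_eq_on.
apply: smeas_eq_of_pos_powers nu_pos => n.
rewrite -!smeas_of_convolution_pow; apply: nonpos_supp_of_charge_sub.
exact: munu.
Qed.

End smeas_of_charge.

(** * Random walks *)

Section random_walk_law.
Context d (T : measurableType d) (R : realType) (P : probability T R).
Implicit Types (xi X : nat -> {RV P >-> R}).

Definition law (Z : {RV P >-> R}) : smeas R := smeas_law P (measurable_funPT Z).

Lemma law_indic (Z : {RV P >-> R}) A : measurable A ->
  law Z \1_A = fine (distribution P Z A).
Proof. by move=> mA; rewrite smeas_law_indic. Qed.

Let event xi (J : {fset nat}) (A : nat -> set R) : set T :=
  \bigcap_(i in [set` J]) (xi i @^-1` A i).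

Let measurable_event xi J A : (forall i, measurable (A i)) ->
  measurable (event xi J A).
Proof.
move=> mA; apply: fin_bigcap_measurable => // i _.
by rewrite -[X in measurable X]setTI; exact: measurable_funPT.
Qed.

(* Carrying along an event of later increments replaces the independence of
   the partial sum and the next increment. *)
Lemma law_partial_sum xi n J A f : mutually_independent xi ->
  identically_distributed xi -> (forall i, measurable (A i)) ->
  (forall i, i \in J -> (n <= i)%N) -> bmeas f ->
  \int[P]_w (f (\sum_(i < n) xi i w) * \1_(event xi J A) w) =
  (law (xi 0%N) ^+ n) f * fine (P (event xi J A)).
Proof.
move=> indep ident; elim: n J A f => [|n IH] J A f mA Jn bf.
  have mE := measurable_event xi J mA.
  under eq_Rintegral do rewrite big_ord0.
  rewrite RintegralZl//; last exact/bmeas_integrable/bmeas_indic.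
  rewrite expr0 -smeas_dirac0 smeas_diracE// /Rintegral integral_indic//.
  by rewrite setIT.
have mE := measurable_event xi J mA; set E := event xi J A in mE *.
rewrite exprSr smeas_mulE// mulrC.
under eq_Rintegral do rewrite big_ord_recr/=.
have mS : measurable_fun setT (fun w => (\sum_(i < n) xi i w, xi n w)).
  by apply/measurable_fun_pair => //; apply: measurable_sum.
have rect C B : measurable C -> measurable B ->
    \int[P]_w (\1_(C `*` B) (\sum_(i < n) xi i w, xi n w) * \1_E w) =
    fine (P E) * (law (xi 0%N) ^+ n)
      (fun x => law (xi 0%N) (fun y => \1_(C `*` B) (x, y))).
  move=> mC mB; rewrite ev_iter_rectangle//.
  (* The condition on increment [n] joins the event, so the induction hypothesis applies with index
     [n] added to [J], and independence then splits it off. *)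
  pose A' i := if i == n then B else A i.
  have mA' i : measurable (A' i) by rewrite /A'; case: ifP.
  have nJ : n \notin J by apply/negP => /Jn; rewrite ltnn.
  have E'E : event xi (n |` J)%fset A' = xi n @^-1` B `&` E.
    apply/seteqP; split=> [w H|w [Bw Ew] i /=].
      split; first by have := H n; rewrite /A' eqxx; apply; rewrite /= !inE eqxx.
      move=> i /= iJ; have := H i; rewrite /A'; case: eqVneq => [ein _|_].
        by move: nJ; rewrite -ein iJ.
      by apply; rewrite /= !inE iJ orbT.
    rewrite !inE /A'; case: eqVneq => [->//|_ /= iJ]; exact: Ew.
  transitivity (\int[P]_w (\1_C (\sum_(i < n) xi i w) *
      \1_(event xi (n |` J)%fset A') w)).
    apply: eq_Rintegral => w _; rewrite E'E.
    rewrite !indicE in_setX in_setI -!natrM !mulnb/= -andbA.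
    by congr (nat_of_bool (_ && (_ && _)))%:R.
  rewrite IH//; last 2 first.
  - by move=> i; rewrite !inE => /orP[/eqP ->//|/Jn/ltnW].
  - exact: bmeas_indic.
  have -> : fine (P (event xi (n |` J)%fset A')) = law (xi 0%N) \1_B * fine (P E).
    have -> : law (xi 0%N) \1_B = fine (P (xi n @^-1` B)).
      by rewrite law_indic// (ident 0%N n).
    rewrite -fineM ?fin_num_measure//; last first.
      by rewrite -[X in measurable X]setTI; exact: measurable_funPT.
    congr fine; rewrite [LHS]indep// [P E]indep// big_fsetU1//= /A' eqxx.
    congr (_ * _)%E; apply: eq_big_seq => i iJ; case: eqVneq => // ein.
    by move: nJ; rewrite -ein iJ.
  by ring.
(* Both sides are continuous functionals of a function of the pair formed by the partial sum and the
   next increment; agreement on rectangles extends to f(x + y). *)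
have cphi := continuous_functional_comp mS (continuous_functional_mul
  (bmeas_indic R mE) (continuous_functional_Rintegral P)).
have cpsi := continuous_functionalZ (fine (P E))
  (continuous_functional_iter (law (xi 0%N) ^+ n) (law (xi 0%N))).
apply: (continuous_functional_eq (measurable_prod_measurableType R R)
  (@setI_closed_rectangles _ _ R R) cphi cpsi _ _ (bmeas_shift bf)).
- by move=> _ [C mC [B mB <-]]; exact: rect.
- by have := rect setT setT measurableT measurableT; rewrite setXTT indicT.
Qed.

Lemma law_random_walk X : random_walk X -> exists m : smeas R,
  forall n, (0 < n)%N -> law (X n) = m ^+ n.
Proof.
move=> [xi [indep ident XE]]; exists (law (xi 0%N)) => n n0.
apply: smeas_eq => f bf.
have := @law_partial_sum xi n fset0 (fun=> setT) f indep ident.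
have -> : event xi fset0 (fun=> setT) = setT.
  by apply/seteqP; split.
rewrite probability_setT mulr1 => <- //.
rewrite smeas_lawE//; apply: eq_Rintegral => w _.
by rewrite indicT mulr1 XE.
Qed.
End random_walk_law.

Lemma eq_in_distributionP (R : realType)
    d1 (T1 : measurableType d1) (P1 : probability T1 R)
    d2 (T2 : measurableType d2) (P2 : probability T2 R)
    (X : {RV P1 >-> R}) (Y : {RV P2 >-> R}) :
  eq_in_distribution X Y <-> law X = law Y.
Proof.
split=> [XY|XY A mA].
  by apply: smeas_eq_indic => A mA; rewrite !law_indic// XY.
rewrite -[LHS]fineK ?fin_num_measure// -[RHS]fineK ?fin_num_measure//.
by rewrite -!law_indic// XY.
Qed.

(** Test functions vanishing on (-oo, 0] do not see the truncation at 0. *)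
Lemma law_max0 (R : realType) d (T : measurableType d) (P : probability T R)
    (X : {RV P >-> R}) (f : R -> R) : bmeas f -> (forall x, x <= 0 -> f x = 0) ->
  law (P := P) (max_mfun X (cst 0)) f = law X f.
Proof.
move=> bf f0; rewrite !smeas_lawE//; apply: eq_Rintegral => w _ /=.
by have [X0|//] := leP (X w) 0; rewrite !f0.
Qed.

Lemma nonpos_suppX (R : realType) (m : smeas R) n :
  nonpos_supp m -> nonpos_supp (m ^+ n).
Proof.
move=> m0; elim: n => [|n IH]; last by rewrite exprS; exact: nonpos_suppM.
by rewrite expr0 -smeas_dirac0; exact: nonpos_supp_dirac.
Qed.

Lemma random_walk_eq_of_max (R : realType)
    d1 (T1 : measurableType d1) (P1 : probability T1 R) (X : nat -> {RV P1 >-> R})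
    d2 (T2 : measurableType d2) (P2 : probability T2 R) (Y : nat -> {RV P2 >-> R}) :
  random_walk X -> random_walk Y -> nondegenerate_walk Y ->
  (forall n, (0 < n)%N -> eq_in_distribution (P1 := P1) (P2 := P2)
    (max_mfun (X n) (cst 0)) (max_mfun (Y n) (cst 0))) ->
  forall n, (0 < n)%N -> eq_in_distribution (X n) (Y n).
Proof.
move=> /law_random_walk[m Xm] /law_random_walk[m' Ym'] [k k0 Yk] maxXY.
suff mm' : m = m'.
  by move=> n n0; apply/eq_in_distributionP; rewrite Xm// Ym'// mm'.
apply: smeas_eq_of_pos_powers => [n f bf f0|m'0].
  rewrite smeas_subE -Xm// -Ym'// -(law_max0 (X n.+1) bf f0) -(law_max0 (Y n.+1) bf f0).
  by have /eq_in_distributionP -> := maxXY n.+1 isT; rewrite subrr.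
(* If [m'] were carried by (-oo, 0], so would be its power [k], the law of [Y k], against
   nondegeneracy. *)
move/eqP: Yk; apply; have mpos := measurable_itv `]0%R : R, +oo[.
have -> : [set w | 0 < Y k w] = Y k @^-1` `]0, +oo[%classic.
  by apply/seteqP; split => w /=; rewrite in_itv/= andbT.
have mYpos : measurable (Y k @^-1` `]0, +oo[%classic).
  by rewrite -[X in measurable X]setTI; exact: measurable_funPT.
rewrite -(fineK (fin_num_measure P2 _ mYpos)).
rewrite -[fine _]/(fine (distribution P2 (Y k) _)) -law_indic// Ym'//.
congr EFin; apply: (nonpos_suppX k m'0); first exact: bmeas_indic.
by move=> x x0; rewrite indicE memNset//= in_itv/= andbT ltNge x0.
Qed.

Theorem theorem1 (R : realType) :
  (forall (d1 : measure_display) (T1 : measurableType d1)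
      (P1 : probability T1 R) (X : nat -> {RV P1 >-> R})
      (d2 : measure_display) (T2 : measurableType d2)
      (P2 : probability T2 R) (Y : nat -> {RV P2 >-> R}),
    random_walk X -> nondegenerate_walk X ->
    random_walk Y -> nondegenerate_walk Y ->
    (forall n, (0 < n)%N ->
      eq_in_distribution (P1 := P1) (P2 := P2)
        (max_mfun (X n) (cst 0)) (max_mfun (Y n) (cst 0))) ->
    forall n, (0 < n)%N -> eq_in_distribution (X n) (Y n)) /\
  (forall mu nu : {charge set R -> \bar R},
    nondegenerate_charge mu -> nondegenerate_charge nu ->
    (forall n, (0 < n)%N ->
      eq_on_measurable (pos_restr (convolution_pow mu n))
                       (pos_restr (convolution_pow nu n))) ->
    eq_on_measurable mu nu).
Proof.
split=> [d1 T1 P1 X d2 T2 P2 Y wX _ wY|mu nu _].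
  exact: random_walk_eq_of_max.
exact: charge_eq_of_pos_convolution_pow.
Qed.
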